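(* Let $n\ge1$, $d\ge2$, $k\ge 1$ and $\ell\ge 1$ be integers. Let $F\in\mathbf{S}^k[x_1,\ldots,x_d]$ be a homogeneous polynomial of degree $2n$ in $d$ variables with values in the real symmetric $k\times k$ matrices, with $0\le F\le I$ on $S^{d-1}$. Then $F+\frac{\mathsf{B}_{2n}}{2}\,\rho_{2n}(d,\ell)\,I$ is $\ell$-sos on $S^{d-1}$ (this being an assertion only when $\rho_{2n}(d,\ell)<\infty$). Furthermore, for every $n\ge1$ there are constants $\mathsf{C}_n,\mathsf{C}'_n>0$, depending only on $n$, such that for every integer $d\ge 2$ with $n\le d$ and every integer $\ell\ge\mathsf{C}'_n d$, $$\rho_{2n}(d,\ell)\le\mathsf{C}_n\,(d/\ell)^2.$$
   Context: $S^{d-1}$ is the unit sphere of $\mathbb{R}^d$; $\mathbf{S}^k[x]$ is the space of polynomials with coefficients in the real symmetric $k\times k$ matrices; matrix inequalities are in the positive semidefinite order. $G\in\mathbf{S}^k[x]$ is $\ell$-sos on $S^{d-1}$ if there are finitely many $U_j\in\mathbb{R}^{k\times k}[x]$ with $\deg U_j\le\ell$ and $G(x)=\sum_jU_j(x)U_j(x)^{\mathsf{T}}$ for all $x\in S^{d-1}$. Gegenbauer polynomials: $(C_i)_{i\ge0}$, $\deg C_i=i$, are the polynomials orthogonal on $[-1,1]$ with respect to the weight $(1-t^2)^{\frac{d-3}{2}}dt$, normalized so that $C_i(1)>0$ and $\int_{-1}^1C_i(t)^2(1-t^2)^{\frac{d-3}{2}}dt=\frac{\omega_d}{\omega_{d-1}}C_i(1)$,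 where $\omega_d$ is the surface area of $S^{d-1}$. The $i$-th Gegenbauer coefficient of a polynomial $\phi$ is $\lambda_i=\frac{\omega_{d-1}}{\omega_d}\int_{-1}^1\phi(t)\frac{C_i(t)}{C_i(1)}(1-t^2)^{\frac{d-3}{2}}dt$, so that $\phi=\sum_i\lambda_iC_i$. $\rho_{2n}(d,\ell)=\min\sum_{k=1}^{n}|\lambda_{2k}^{-1}-1|$, where the minimum is over real univariate polynomials $q$ of degree at most $\ell$ such that the Gegenbauer coefficients $\lambda_i$ of $\phi=q^2$ satisfy $\lambda_0=1$ (the sum is $+\infty$ if some $\lambda_{2k}=0$). $\mathsf{B}_{2n}$ is the smallest constant such that, for every $d$ and every real homogeneous polynomial $f$ of degree $2n$ in $d$ variables, whose restriction to $S^{d-1}$ has spherical harmonic decomposition $f=\sum_{k=0}^nf_{2k}$ ($f_{2k}$ the restriction to $S^{d-1}$ of a homogeneous harmonic polynomial of degree $2k$), one has $\|f_{2k}\|_\infty\le\mathsf{B}_{2n}\|f\|_\infty$ for all $k=0,\ldots,n$, where $\|\cdot\|_\infty$ is the sup norm on $S^{d-1}$; such a finite constant, depending only on $n$, exists. *)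

(* Defs.v *)
(* The notations of mpoly clash with those of MathComp-Analysis and are not
   imported: [mpoly d R] is the ring of polynomials in d variables, and
   [ishomog1 m mdeg] is the predicate of homogeneity of degree m. *)
From HB Require Import structures.
From mathcomp Require Export all_boot all_order all_algebra.
From mathcomp Require Export all_classical all_reals all_analysis.
From mathcomp Require Export -(notations) mpoly.

Set Implicit Arguments.
Unset Strict Implicit.
Unset Printing Implicit Defensive.

Import Order.TTheory GRing.Theory Num.Theory.

Local Open Scope classical_set_scope.
Local Open Scope ring_scope.

Section Sphere.
Variable R : realType.

(* Squared Euclidean norm; the library norm on ['rV_m] is the max norm. *)
Definition sqnorm (m : nat) (x : 'rV[R]_m) : R := \sum_i x ord0 i ^+ 2.

Definition sphere (d : nat) : set 'rV[R]_d := [set x | sqnorm x = 1].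
Arguments sphere d _ : clear implicits.

(* Lebesgue integral over R^m of a nonnegative measurable function, as an
   iterated integral (Tonelli). *)
Fixpoint integral_rV (m : nat) : ('rV[R]_m -> \bar R) -> \bar R :=
  match m return ('rV[R]_m -> \bar R) -> \bar R with
  | 0%N => fun f => f 0
  | m'.+1 => fun f => (\int[lebesgue_measure]_(t in [set: R])
      integral_rV (fun y : 'rV[R]_m' => f (row_mx (t%:M : 'M[R]_1) y)))%E
  end.

(* Surface area of the unit sphere of R^d, d >= 1: up to the (null) equator it
   is the union of the graphs of y |-> +/- sqrt (1 - |y|^2) over the open unit
   ball of R^(d-1), whose area element is dy / sqrt (1 - |y|^2).  For d = 1
   this gives the two points of S^0 mass one each. *)
Definition sphere_area (d : nat) : R :=
  2 * fine (integral_rV (fun y : 'rV[R]_d.-1 =>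
    (if sqnorm y < 1 then (Num.sqrt (1 - sqnorm y))^-1 else 0)%:E)).

Definition mpoly_at (d : nat) (x : 'rV[R]_d) (p : mpoly d R) : R :=
  meval (fun i => x ord0 i) p.

Definition supnorm (d : nat) (p : mpoly d R) : R :=
  sup [set `|mpoly_at x p| | x in sphere d].

Definition laplacian (d : nat) (p : mpoly d R) : mpoly d R :=
  \sum_(i < d) mderiv i (mderiv i p).

(* [h k] is the component of degree 2k; only its values on the sphere matter. *)
Definition is_harmonic_decomposition (n d : nat) (f : mpoly d R)
    (h : 'I_n.+1 -> mpoly d R) : Prop :=
  (forall k, h k \is @ishomog1 d R (2 * k)%N mdeg /\ laplacian (h k) = 0) /\
  (forall x, sphere d x -> mpoly_at x f = \sum_k mpoly_at x (h k)).

Definition harmonic_bound (n : nat) (B : R) : Prop :=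
  forall (d : nat) (f : mpoly d R) (h : 'I_n.+1 -> mpoly d R),
    (1 <= d)%N -> f \is @ishomog1 d R (2 * n)%N mdeg ->
    is_harmonic_decomposition f h ->
    forall k, supnorm (h k) <= B * supnorm f.

(* B_{2n}.  The set of admissible constants is nonempty, bounded below and
   closed, so that its infimum is its least element. *)
Definition harmonic_const (n : nat) : R := inf [set B | harmonic_bound n B].

End Sphere.

Arguments sphere {R} d _.

Section Gegenbauer.
Variable R : realType.

Definition gegenbauer_int (d : nat) (p : {poly R}) : R :=
  \int[lebesgue_measure]_(t in `[-1, 1])
    (p.[t] * (1 - t ^+ 2) `^ ((d%:R - 3) / 2)).

Definition is_gegenbauer (d : nat) (C : nat -> {poly R}) : Prop :=
  [/\ forall i, size (C i) = i.+1,
      forall i j, i <> j -> gegenbauer_int d (C i * C j) = 0,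
      forall i, 0 < (C i).[1] &
      forall i, gegenbauer_int d (C i ^+ 2) =
        sphere_area R d / sphere_area R d.-1 * (C i).[1]].

(* For d >= 2 exactly one family satisfies [is_gegenbauer d]. *)
Definition gegenbauer (d : nat) : nat -> {poly R} :=
  xget (fun=> 0) [set C | is_gegenbauer d C].

Definition gegenbauer_coef (d : nat) (phi : {poly R}) (i : nat) : R :=
  sphere_area R d.-1 / sphere_area R d *
  gegenbauer_int d (phi * ((gegenbauer d i).[1]^-1 *: gegenbauer d i)).

Definition inv_deviation (a : R) : \bar R :=
  if a == 0 then +oo%E else `|a^-1 - 1|%:E.

(* rho_{2n}(d, l).  The normalization makes the set of admissible q compact and
   the objective is continuous with values in [0, +oo], so that the infimum is a
   minimum.  Its value is +oo when every admissible q has some vanishing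
   coefficient. *)
Definition rho (n d l : nat) : \bar R :=
  ereal_inf [set (\sum_(1 <= k < n.+1)
                    inv_deviation (gegenbauer_coef d (q ^+ 2) (2 * k)%N))%E
            | q in [set q : {poly R} | (size q <= l.+1)%N /\
                                       gegenbauer_coef d (q ^+ 2) 0%N = 1]].

End Gegenbauer.

Section MatrixSos.
Variable R : realType.

Definition psd (k : nat) (A : 'M[R]_k) : Prop :=
  A^T = A /\ forall v : 'cV[R]_k, 0 <= (v^T *m A *m v) ord0 ord0.

Definition loewner_le (k : nat) (A B : 'M[R]_k) : Prop := psd (B - A).

(* Polynomials in d variables with k x k matrix coefficients are represented as
   k x k matrices of polynomials; symmetric coefficients means [G^T = G]. *)
Definition mx_at (d k : nat) (x : 'rV[R]_d) (G : 'M[mpoly d R]_k) : 'M[R]_k :=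
  map_mx (mpoly_at x) G.

(* [mmeasure mdeg p] is the size of p, i.e. 1 + its degree (0 if p = 0). *)
Definition is_sos (d k l : nat) (G : 'M[mpoly d R]_k) : Prop :=
  exists Us : seq 'M[mpoly d R]_k,
    (forall U, U \in Us -> forall i j, (mmeasure mdeg (U i j) <= l.+1)%N) /\
    (forall x, sphere d x ->
       mx_at x G = \sum_(U <- Us) mx_at x U *m (mx_at x U)^T).

End MatrixSos.

(* Main.v *)
(* A polynomial q of degree l whose square has Gegenbauer coefficients lambda_i
   gives the operator K : h |-> avg_y [q(<x,y>)^2 h(y)] on the sphere.  By
   Funk-Hecke, K multiplies harmonics of degree i by lambda_i, so F + delta I
   equals K H with H = F_0 + sum_k F_{2k} / lambda_{2k} + delta I, and the bound
   on the harmonic components of F - I/2 makes H positive as soon as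
   delta >= B/2 sum_k |1/lambda_{2k} - 1|.  Expanding q(<x,y>) as a sum of
   products u_a(x) v_a(y) turns K H into a sum of squares.

   The average over the sphere is defined algebraically, from iterated
   Laplacians at the origin; it is positive because avg p is the value at the
   origin of the harmonic extension of p, to which the maximum principle applies.
   Each harmonic component of f is the image of f under a polynomial in the
   operator |x|^2 Laplacian, whose norm is O(d) and whose eigenvalue gaps are of
   order d; this bounds the component independently of d.

   For the rate, q is a combination of Gegenbauer polynomials with linearly
   decreasing weights: then avg[(1-t) q^2] <= (d/l)^2 avg[q^2], while
   |1 - P_{2k}(t)| <= C_k (1-t) uniformly in d. *)
Require Import Defs.
From mathcomp Require Import measurable_realfun ring lra zify.
Set Implicit Arguments.
Unset Strict Implicit.
Unset Printing Implicit Defensive.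
Import Order.TTheory GRing.Theory Num.Theory numFieldNormedType.Exports.
Local Open Scope classical_set_scope.
Local Open Scope ring_scope.

(** The lambda_i are integrals over [-1, 1], whereas K averages over the sphere. The two meet in a
    recursion on an exponent m: the moments of t^m against P_i and the averages of <x, y>^m against
    a harmonic polynomial obey the same one. The Gegenbauer theory is therefore developed for an
    abstract functional J given by its moment recursion, and the positive factor between the two
    averages is absorbed into the constant [r] of [sos_of_rho].

    The shift contains the exact value of rho, so an optimal q has to be produced. The objective has
    poles where a coefficient vanishes; the minimum is taken over a compact set on which the
    relevant coefficients stay away from 0.

    H is only known to be nonnegative on the sphere. The passage to squares is finite-dimensional: K
    H at x is a quadratic form in the finitely many values u_a(x), its Gram matrix consists of the
    averages of v_a v_b H and is positive because H is, and factoring this matrix yields the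
    squares. Only the degrees of the u_a count, hence the bound l. *)

Lemma poly_basis (F : fieldType) (C : nat -> {poly F}) n (p : {poly F}) :
  (forall i, size (C i) = i.+1) -> (size p <= n)%N ->
  exists c : nat -> F, p = \sum_(i < n) c i *: C i.
Proof.
move=> sC; elim: n p => [|n IH] p sp.
  by exists (fun=> 0); rewrite big_ord0; apply/eqP; rewrite -size_poly_eq0 -leqn0.
pose a := p`_n / lead_coef (C n).
have /IH[c e] : (size (p - a *: C n)%R <= n)%N.
  apply/leq_sizeP => j; rewrite leq_eqVlt coefB coefZ => /orP[/eqP<-|nj].
    have : lead_coef (C n) != 0 by rewrite lead_coef_eq0 -size_poly_eq0 sC.
    by rewrite /a lead_coefE sC /= => ?; rewrite divfK ?subrr.
  by rewrite !nth_default ?mulr0 ?subrr // ?sC // (leq_trans sp).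
exists (fun i => if i == n then a else c i).
rewrite big_ord_recr /= eqxx -[p in LHS](subrK (a *: C n)) e; congr (_ + _).
by apply: eq_bigr => i _; rewrite ltn_eqF.
Qed.

(** * Gegenbauer polynomials *)

Section NormalizedGegenbauer.
Variables (R : realFieldType) (D : R).

(* Gegenbauer polynomials of dimension D, normalized by P_i(1) = 1. *)
Fixpoint gegP_rec (i : nat) : {poly R} :=
  match i with
  | 0 => 1
  | i'.+1 => match i' with
    | 0 => 'X
    | j.+1 => (j%:R + D - 1)^-1 *:
        ((2 * j%:R + D) *: ('X * gegP_rec i') - (j%:R + 1) *: gegP_rec j)
    end
  end.

Definition gegP : nat -> {poly R} := locked gegP_rec.

Lemma gegP0 : gegP 0 = 1. Proof. by rewrite /gegP -lock. Qed.

Lemma gegP1 : gegP 1 = 'X. Proof. by rewrite /gegP -lock. Qed.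

Lemma gegPSS (hD : 2 <= D) j : (j%:R + D - 1) *: gegP j.+2 =
  (2 * j%:R + D) *: ('X * gegP j.+1) - (j%:R + 1) *: gegP j.
Proof.
have j0 : 0 <= j%:R :> R by exact: ler0n.
rewrite /gegP -lock [in LHS]/= scalerA divff ?scale1r //.
by apply: lt0r_neq0; lra.
Qed.

Lemma gegP_horner1 (hD : 2 <= D) i : (gegP i).[1] = 1.
Proof.
elim/ltn_ind: i => -[|[|i]] IH; first by rewrite gegP0 hornerC.
  by rewrite gegP1 hornerX.
have j0 : 0 <= i%:R :> R by exact: ler0n.
have jn : i%:R + D - 1 != 0 by apply: lt0r_neq0; lra.
apply: (mulfI jn); rewrite -hornerZ gegPSS // !(hornerD, hornerN, hornerZ, hornerM, hornerX) !IH //; ring.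
Qed.

Lemma size_gegP (hD : 2 <= D) i : size (gegP i) = i.+1 /\ 0 < lead_coef (gegP i).
Proof.
elim/ltn_ind: i => -[|[|i]] IH.
- by rewrite gegP0 size_poly1 lead_coef1.
- by rewrite gegP1 size_polyX lead_coefX.
have [s1 l1] := IH i.+1 (ltnSn _); have [s0 l0] := IH i (ltnW (ltnSn _)).
have j0 : 0 <= i%:R :> R by exact: ler0n.
have n0 : gegP i.+1 != 0 by rewrite -size_poly_eq0 s1.
have sX : size ((2 * i%:R + D) *: ('X * gegP i.+1)) = i.+3.
  by rewrite size_scale ?size_mulX ?s1 //; [rewrite mulrC size_mulX ?s1|apply: lt0r_neq0; lra].
have sl : (size (- ((i%:R + 1) *: gegP i)) < i.+3)%N.
  by rewrite size_polyN (leq_ltn_trans (size_scale_leq _ _)) // s0.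
have c0 : (i%:R + D - 1)^-1 != 0 by rewrite invr_eq0; apply: lt0r_neq0; lra.
have -> : gegP i.+2 = (i%:R + D - 1)^-1 *: ((2 * i%:R + D) *: ('X * gegP i.+1) - (i%:R + 1) *: gegP i).
  by rewrite -gegPSS // scalerA mulVf ?scale1r // -invr_eq0.
split.
  by rewrite size_scale // size_polyDl ?sX.
rewrite lead_coefZ lead_coefDl ?sX // lead_coefZ [_ * gegP _]mulrC lead_coefMX.
by rewrite !mulr_gt0 ?invr_gt0 //; lra.
Qed.

(* Coefficientwise, the recurrence gives the bound
   |P_{i+2}| <= 2 |P_{i+1}| + |P_i|, uniformly in D >= 2. *)
Lemma gegP_coef_bound (hD : 2 <= D) i j : `|(gegP i)`_j| <= 3 ^+ i.
Proof.
elim/ltn_ind: i j => -[|[|i]] IH j.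
- by rewrite gegP0 coef1; case: eqP; rewrite ?normr1 ?normr0 ?expr0.
- by rewrite gegP1 coefX expr1; case: eqP; rewrite ?normr1 ?normr0; lra.
have j0 : 0 <= i%:R :> R by exact: ler0n.
have jp : 0 < i%:R + D - 1 by lra.
have E : (i%:R + D - 1) * (gegP i.+2)`_j =
    (2 * i%:R + D) * (if j == 0%N then 0 else (gegP i.+1)`_j.-1) -
    (i%:R + 1) * (gegP i)`_j.
  by rewrite -[LHS]coefZ gegPSS // coefB !(coefZ _ (gegP _)) coefZ coefXM.
have X1 : `|if j == 0%N then 0 else (gegP i.+1)`_j.-1| <= 3 ^+ i.+1.
  by case: eqP => _; [rewrite normr0 exprn_ge0|exact: IH].
have X2 : `|(gegP i)`_j| <= 3 ^+ i by exact: IH (ltnW _) _.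
rewrite -(ler_pM2l jp) -{1}(gtr0_norm jp) -normrM E.
apply: le_trans (ler_normB _ _) _; rewrite !normrM.
rewrite ger0_norm ?[`|_ + 1|]ger0_norm ?addr_ge0 ?mulr_ge0 //; try lra.
apply: le_trans (lerD (ler_wpM2l _ X1) (ler_wpM2l _ X2)) _; try lra.
have e0 : 0 <= (3 : R) ^+ i by exact: exprn_ge0.
rewrite !exprS; nra.
Qed.

Lemma norm_1Xn (t : R) n : -1 <= t <= 1 -> `|1 - t ^+ n| <= n%:R * (1 - t).
Proof.
move=> /andP[t1 t2]; elim: n => [|n IH].
  by rewrite expr0 subrr normr0 mul0r.
have -> : 1 - t ^+ n.+1 = (1 - t ^+ n) + t ^+ n * (1 - t) by rewrite exprS; ring.
apply: le_trans (ler_normD _ _) _; rewrite -natr1 mulrDl mul1r lerD // normrM.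
rewrite (@ger0_norm _ (1 - t)); last lra.
have : `|t ^+ n| <= 1 by rewrite normrX exprn_ile1 // ler_norml t1.
by move=> ?; nra.
Qed.

(** As P_k(1) = 1, the difference is a combination of the 1 - t^i, each of which is O(1 - t); the
    coefficient bound keeps the constant free of D. *)
Lemma gegP_near1 (hD : 2 <= D) k t : -1 <= t <= 1 ->
  `|1 - (gegP k).[t]| <= 3 ^+ k * (k.+1 * k.+1)%N%:R * (1 - t).
Proof.
move=> ht.
have sk : (size (gegP k) <= k.+1)%N by rewrite (proj1 (size_gegP hD k)).
have -> : 1 - (gegP k).[t] = \sum_(i < k.+1) (gegP k)`_i * (1 - t ^+ i).
  rewrite -[in LHS](gegP_horner1 hD k) !(horner_coef_wide _ sk) -sumrB.
  by apply: eq_bigr => i _; rewrite expr1n -mulrBr.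
apply: le_trans (ler_norm_sum _ _ _) _.
have t0 : 0 <= 1 - t by case/andP: ht => _; lra.
apply: (@le_trans _ _ (\sum_(i < k.+1) 3 ^+ k * k.+1%:R * (1 - t))); last first.
  by rewrite sumr_const card_ord -[leLHS]mulr_natr natrM; lra.
apply: ler_sum => i _; rewrite normrM -mulrA.
apply: ler_pM => //; first exact: gegP_coef_bound.
apply: le_trans (norm_1Xn _ ht) _; rewrite ler_wpM2r // ler_nat ltnW //.
Qed.

Section Moments.
Variable J : {poly R} -> R.

(* The moment recursion of the weight (1 - t^2)^((D-3)/2) on [-1, 1], which
   determines J up to a positive factor. *)
Record gegenbauer_functional : Prop := GegenbauerFunctional {
  gegf_linear : forall a p q, J (a *: p + q) = a * J p + J q;
  gegf_gt0 : 0 < J 1;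
  gegf_X : J 'X = 0;
  gegf_XnSS : forall m, (m%:R + D) * J 'X^(m.+2) = (m%:R + 1) * J 'X^m }.

Hypothesis HJ : gegenbauer_functional.
Hypothesis hD : 2 <= D.

Lemma gegfD p q : J (p + q) = J p + J q.
Proof. by rewrite -[p]scale1r (gegf_linear HJ) !mul1r scale1r. Qed.

Lemma gegf0 : J 0 = 0.
Proof. by apply: (@addrI _ (J 0)); rewrite -gegfD !addr0. Qed.

Lemma gegfZ a p : J (a *: p) = a * J p.
Proof. by rewrite -[a *: p]addr0 (gegf_linear HJ) gegf0 addr0. Qed.

Lemma gegfB p q : J (p - q) = J p - J q.
Proof. by rewrite gegfD -scaleN1r gegfZ mulN1r. Qed.

Lemma gegf_sum I (r : seq I) (P : pred I) (F : I -> {poly R}) :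
  J (\sum_(i <- r | P i) F i) = \sum_(i <- r | P i) J (F i).
Proof. exact: (big_morph J gegfD gegf0). Qed.

(** Orthogonality is the vanishing of these mixed moments for m < i. *)
Definition gegm m i := J ('X^m * gegP i).

Lemma gegm_m1 m : gegm m 1 = gegm m.+1 0.
Proof. by rewrite /gegm gegP1 gegP0 mulr1 -exprSr. Qed.

Lemma gegm_SS m j : (j%:R + D - 1) * gegm m j.+2 =
  (2 * j%:R + D) * gegm m.+1 j.+1 - (j%:R + 1) * gegm m j.
Proof.
transitivity (J ('X^m * ((j%:R + D - 1) *: gegP j.+2))).
  by rewrite -scalerAr gegfZ.
by rewrite gegPSS // mulrBr -!scalerAr gegfB !gegfZ /gegm exprSr mulrA.
Qed.

(** The recurrence shifted down by one; at i = 0 the truncated predecessor is harmless because of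
    its factor i. *)
Lemma gegm_S m i : (i%:R + D - 2) * gegm m i.+1 =
  (2 * i%:R + D - 2) * gegm m.+1 i - i%:R * gegm m i.-1.
Proof.
case: i => [|i]; first by rewrite gegm_m1; ring.
have := gegm_SS m i; rewrite /= -(natr1 i).
have -> : i%:R + 1 + D - 2 = i%:R + D - 1 by ring.
by move=> ->; ring.
Qed.

(* This is Gegenbauer's differential equation for P_i, tested against t^m. *)
Lemma gegm_rec m i : (m%:R + i%:R) * (m%:R + i%:R + D - 2) * gegm m i =
  m%:R * (m%:R - 1) * gegm m.-2 i + 2 * m%:R * i%:R * gegm m.-1 i.-1.
Proof.
have rec0 k : k%:R * (k%:R + D - 2) * gegm k 0 = k%:R * (k%:R - 1) * gegm k.-2 0.
  rewrite /gegm gegP0 !mulr1; case: k => [|[|k]]; first by rewrite !mul0r.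
    by rewrite expr1 (gegf_X HJ) subrr !(mulr0, mul0r).
  rewrite /=; have := gegf_XnSS HJ k; rewrite -(natr1 k.+1) -(natr1 k) => e.
  transitivity ((k%:R + 1 + 1) * ((k%:R + D) * J 'X^(k.+2))); first ring.
  by rewrite e; ring.
have sub0 (x y : R) : x = y -> x - y = 0 by move=> ->; rewrite subrr.
elim/ltn_ind: i m => -[|[|i]] IH m.
- by rewrite addr0 rec0; ring.
- case: m => [|m].
    by rewrite gegm_m1 /gegm gegP0 mulr1 expr1 (gegf_X HJ) !(mulr0, mul0r, addr0).
  have := rec0 m.+2; rewrite /= !gegm_m1 -(natr1 m.+1) -(natr1 m) => e.
  case: m e => [|m] e /=; rewrite ?gegm_m1; lra.
- have jD : i%:R + D - 1 != 0.
    by apply: lt0r_neq0; have := hD; have := ler0n R i; lra.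
  apply: (mulfI jD); apply/eqP; rewrite -subr_eq0; apply/eqP.
  have R1 := IH i.+1 (ltnSn _).
  have R0 := IH i (ltnW (ltnSn _)) m.
  have S0 := gegm_SS m i.
  case: m => [|m] in R0 S0 *.
    have {R1} := R1 1%N; rewrite /= -?(natr1 i.+1) -(natr1 i) -?(natr1 m.+1) -?(natr1 m) in R0 S0 * => /sub0 R1.
    move/sub0: R0 => R0; move/sub0: S0 => S0.
    transitivity ((i%:R + 2) * (i%:R + D) *
      ((i%:R + D - 1) * gegm 0 i.+2 -
       ((2 * i%:R + D) * gegm 1 i.+1 - (i%:R + 1) * gegm 0 i)) +
      (2 * i%:R + D) * ((1 + (i%:R + 1)) * (1 + (i%:R + 1) + D - 2) * gegm 1 i.+1 -
      (1 * (1 - 1) * gegm 0 i.+1 + 2 * 1 * (i%:R + 1) * gegm 0 i))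
      - (i%:R + 1) * ((0 + i%:R) * (0 + i%:R + D - 2) * gegm 0 i -
     (0 * (0 - 1) * gegm 0 i + 2 * 0 * i%:R * gegm 0 i.-1))).
      ring.
    by rewrite S0 R1 R0 !mulr0 !addr0 subr0.
  have {R1} := R1 m.+2; rewrite /= -?(natr1 i.+1) -(natr1 i) -?(natr1 m.+1) -?(natr1 m) in R0 S0 * => /sub0 R1.
  move/sub0: R0 => R0; move/sub0: S0 => S0.
  have /sub0 S1 := gegm_S m i.
  (* The factor m covers m = 0, where the predecessor is truncated. *)
  have /sub0 S2 : m%:R * ((i%:R + D - 1) * gegm m.-1 i.+2) =
      m%:R * ((2 * i%:R + D) * gegm m i.+1 - (i%:R + 1) * gegm m.-1 i).
    by case: m {R0 R1 S0 S1} => [|m]; [rewrite !mul0r|rewrite gegm_SS].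
  set a := gegm m.+2 _ in R1 S0 *; set b := gegm m.+1 i.+2 in S0 *.
  (* The goal is a linear combination of five vanishing relations: the recurrence in i at three
     exponents (S0, S1, S2) and the induction hypotheses (R1, R0). The multipliers are inserted by
     hand so that [ring] can check the identity. *)
  rewrite -[LHS]subr0 -[in LHS](mulr0 ((m%:R + 1 + (i%:R + 1 + 1)) * (m%:R + 1 + (i%:R + 1 + 1) + D - 2))) -[in LHS]S0.
  rewrite -[LHS]subr0 -[in LHS](mulr0 (2 * i%:R + D)) -[in LHS]R1.
  rewrite -[LHS]addr0 -[in LHS](mulr0 (m%:R + 1)) -[in LHS]S2.
  rewrite -[LHS]addr0 -[in LHS](mulr0 (i%:R + 1)) -[in LHS]R0.
  rewrite -[LHS]addr0 -[in LHS](mulr0 (2 * (m%:R + 1) * (i%:R + 1))) -[in LHS]S1.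
  ring.
Qed.

(** In [gegm_rec] the right-hand moments still have exponent below the index, or carry a zero
    factor, while the left coefficient is positive. *)
Lemma gegm_eq0 m i : (m < i)%N -> gegm m i = 0.
Proof.
elim/ltn_ind: m i => m IH i mi.
have := gegm_rec m i.
have -> : m%:R * (m%:R - 1) * gegm m.-2 i = 0.
  case: m {IH} mi (IH m.-2) => [|[|m]] mi IH; rewrite ?(mul0r, subrr, mulr0) //.
  by rewrite IH ?mulr0 //=; lia.
have -> : 2 * m%:R * i%:R * gegm m.-1 i.-1 = 0.
  case: m {IH} mi (IH m.-1) => [|m] mi IH; rewrite ?(mul0r, mulr0) //.
  by rewrite IH ?mulr0 //=; lia.
move/eqP; rewrite addr0 !mulf_eq0 => /orP[/orP[|]|/eqP//]; apply: contraTeq => _.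
  by apply: lt0r_neq0; rewrite -natrD ltr0n addn_gt0 (leq_ltn_trans _ mi) ?orbT.
apply: lt0r_neq0; have := hD; have := ler0n R m.
have : 1 <= i%:R :> R by rewrite ler1n (leq_ltn_trans _ mi).
lra.
Qed.

(** On the diagonal the first term of [gegm_rec] vanishes by orthogonality, which leaves a positive
    multiple of the previous diagonal moment. *)
Lemma gegm_diag_gt0 i : 0 < gegm i i.
Proof.
elim: i => [|i IH]; first by rewrite /gegm gegP0 mulr1; exact: gegf_gt0.
have := gegm_rec i.+1 i.+1; rewrite (@gegm_eq0 i.+1.-2); last by case: i {IH}.
rewrite mulr0 add0r /= -(natr1 i) => e.
have i0 := ler0n R i; have D2 := hD.
have A0 : 0 < (i%:R + 1 + (i%:R + 1)) * (i%:R + 1 + (i%:R + 1) + D - 2).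
  by rewrite mulr_gt0 //; lra.
by rewrite -(pmulr_rgt0 _ A0) e !mulr_gt0 //; lra.
Qed.

Lemma gegf_mul_gegP (p : {poly R}) i : J (p * gegP i) = \sum_(m < size p) p`_m * gegm m i.
Proof.
rewrite -[in LHS](coefK p) poly_def mulr_suml gegf_sum.
by apply: eq_bigr => j _; rewrite -scalerAl gegfZ.
Qed.

Lemma gegf_lower (p : {poly R}) i : (size p <= i)%N -> J (p * gegP i) = 0.
Proof.
move=> sp; rewrite gegf_mul_gegP big1 // => m _.
by rewrite gegm_eq0 ?mulr0 // (leq_trans (ltn_ord m)).
Qed.

Lemma gegP_orth i j : i != j -> J (gegP i * gegP j) = 0.
Proof.
rewrite neq_ltn => /orP[] h; last rewrite mulrC; apply: gegf_lower.
  by rewrite (proj1 (size_gegP hD _)).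
by rewrite (proj1 (size_gegP hD _)).
Qed.

Lemma gegP_norm_gt0 i : 0 < J (gegP i ^+ 2).
Proof.
rewrite expr2 gegf_mul_gegP (proj1 (size_gegP hD i)) big_ord_recr /= big1.
  rewrite add0r mulr_gt0 ?gegm_diag_gt0 //.
  by have := proj2 (size_gegP hD i); rewrite lead_coefE (proj1 (size_gegP hD i)).
by move=> m _; rewrite gegm_eq0 ?mulr0.
Qed.

Lemma gegf_basis_mul n (c : nat -> R) j : (j < n)%N ->
  J ((\sum_(i < n) c i *: gegP i) * gegP j) = c j * J (gegP j ^+ 2).
Proof.
move=> jn; rewrite mulr_suml gegf_sum (bigD1 (Ordinal jn)) //= big1 ?addr0.
  by rewrite -scalerAl gegfZ -expr2.
by move=> k kj; rewrite -scalerAl gegfZ gegP_orth ?mulr0.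
Qed.

Lemma gegf_sqr_basis n (c : nat -> R) :
  J ((\sum_(i < n) c i *: gegP i) ^+ 2) = \sum_(i < n) c i ^+ 2 * J (gegP i ^+ 2).
Proof.
rewrite expr2 {2}[\sum_(i < n) _]lock mulr_suml gegf_sum; apply: eq_bigr => i _.
by rewrite -scalerAl gegfZ [gegP i * _]mulrC -lock gegf_basis_mul // mulrA -expr2.
Qed.

(** Each P_j with j < i is a combination of the C_k with k < i, so C_i is orthogonal to it and must
    be a multiple of P_i; the values at 1 fix the factor. *)
Lemma orthogonal_gegP (C : nat -> {poly R}) :
  (forall i, size (C i) = i.+1) -> (forall i j, i <> j -> J (C i * C j) = 0) ->
  (forall i, 0 < (C i).[1]) -> forall i, (C i).[1]^-1 *: C i = gegP i.
Proof.
move=> sC oC pC i.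
have sP j : size (gegP j) = j.+1 := proj1 (size_gegP hD j).
have [c e] := poly_basis sP (eq_leq (sC i)).
have c0 j : (j < i)%N -> c j = 0.
  move=> ji; have [b eb] := poly_basis sC (eq_leq (sP j)).
  have : J (C i * gegP j) = 0.
    rewrite eb mulr_sumr gegf_sum big1 // => k _.
    rewrite -scalerAr gegfZ oC ?mulr0 //; apply/eqP.
    by rewrite gtn_eqF // (leq_trans (ltn_ord k)).
  rewrite e gegf_basis_mul ?(leqW ji) // => /eqP.
  by rewrite mulf_eq0 [J _ == 0]gt_eqF ?gegP_norm_gt0 // orbF => /eqP.
rewrite big_ord_recr /= big1 ?add0r in e; last first.
  by move=> k _; rewrite c0 ?scale0r.
rewrite {2}e e hornerZ gegP_horner1 // mulr1 scalerA mulVf ?scale1r //.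
by have := pC i; rewrite e hornerZ gegP_horner1 // mulr1 => /lt0r_neq0.
Qed.
End Moments.
End NormalizedGegenbauer.

(** * The test polynomial *)

Section TestPolynomial.
Variables (R : realFieldType) (D : R) (J : {poly R} -> R).
Hypothesis HJ : gegenbauer_functional D J.
Hypothesis hD : 2 <= D.
Local Notation P := (gegP D).

(** The binomial coefficient of m + D - 2 over m. *)
Definition rbin (m : nat) : R := \prod_(i < m) ((i%:R + D - 1) / (i%:R + 1)).
(* The dimension of the space of spherical harmonics of degree m, for D = d. *)
Definition harmdim (m : nat) : R := if m is k.+1 then rbin m + rbin k else 1.

Lemma rbinS m : (m%:R + 1) * rbin m.+1 = (m%:R + D - 1) * rbin m.
Proof.
rewrite /rbin big_ord_recr /=; have m0 := ler0n R m.
by rewrite mulrCA [_ * (_ / _)]mulrC divfK 1?mulrC // lt0r_neq0 //; lra.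
Qed.

Lemma rbin_gt0 m : 0 < rbin m.
Proof.
apply: prodr_gt0 => i _; have i0 := ler0n R i; have D2 := hD.
by rewrite divr_gt0 //; lra.
Qed.

Lemma harmdim_gt0 m : 0 < harmdim m.
Proof. by case: m => //= m; rewrite addr_gt0 ?rbin_gt0. Qed.

Lemma rbin_le_harmdim m : rbin m <= harmdim m.
Proof.
case: m => [|m]; first by rewrite /rbin big_ord0.
by rewrite lerDl ltW ?rbin_gt0.
Qed.

(** The three-term recurrence, rescaled so that its coefficients are consecutive values of [rbin];
    this is what makes sums over j telescope. *)
Lemma mulX_gegP j : harmdim j *: ('X * P j) =
  rbin j *: P j.+1 + (if j is k.+1 then rbin k *: P k else 0).
Proof.
case: j => [|j]; first by rewrite gegP0 gegP1 /rbin big_ord0 mulr1 addr0.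
have j0 := ler0n R j; have D2 := hD.
have nz : j%:R + 1 != 0 :> R by apply: lt0r_neq0; lra.
have e1 : (j%:R + 1) * harmdim j.+1 = rbin j * (2 * j%:R + D).
  by rewrite mulrDr rbinS; ring.
apply: (scalerI nz); rewrite scalerDr !scalerA e1 rbinS. rewrite [X in X *: P j.+2]mulrC.
rewrite -[X in _ = X + _]scalerA gegPSS // scalerBr !scalerA.
by rewrite [X in - (X *: _)]mulrC subrK.
Qed.

(** The analogue of the Fejer kernel: up to the factor l + 1, the Cesaro mean of the expansion of
    the point mass at t = 1. *)
Definition fejer l : {poly R} :=
  \sum_(j < l.+1) ((l.+1%:R - j%:R) * harmdim j) *: P j.

(* Multiplication by 1 - t telescopes each partial sum of [harmdim j *: P j],
   and [fejer l] is the sum of these partial sums. *)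
Lemma mul_1X_fejer l :
  (1 - 'X) * fejer l = \sum_(j < l.+1) rbin j *: (P j - P j.+1).
Proof.
have K n : (1 - 'X) * (\sum_(j < n.+1) harmdim j *: P j) =
    rbin n *: (P n - P n.+1).
  elim: n => [|n IH].
    by rewrite big_ord1 /rbin big_ord0 /= !scale1r gegP0 gegP1 mulr1.
  rewrite big_ord_recr mulrDr IH mulrBl mul1r -scalerAr mulX_gegP.
  by rewrite /= scalerDl !scalerBr; ring.
elim: l => [|l IH].
  by rewrite /fejer !big_ord1 /= subr0 mulr1 /rbin big_ord0 !scale1r gegP0 gegP1 mulr1.
have -> : fejer l.+1 = fejer l + \sum_(j < l.+2) harmdim j *: P j.
  rewrite /fejer !(@big_ord_recr _ _ _ l.+1) /= [RHS]addrA -big_split /=.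
  congr (_ + _); last by rewrite -natr1 addrAC subrr add0r mul1r.
  by apply: eq_bigr => i _; rewrite -scalerDl -(natr1 l.+1); congr (_ *: _); ring.
by rewrite mulrDr IH K [in RHS]big_ord_recr.
Qed.

(** Evaluating J(t P_j P_{j+1}) in two ways, by expanding t P_j or t P_{j+1}, relates consecutive
    norms. *)
Lemma gegP_normE j : harmdim j * J (P j ^+ 2) = J 1.
Proof.
elim: j => [|j IH]; first by rewrite /= gegP0 expr1n mul1r.
have o k : J (P k * P k.+2) = 0 by rewrite gegP_orth // ltn_eqF // leqW.
have E1 : harmdim j * J ('X * P j * P j.+1) = rbin j * J (P j.+1 ^+ 2).
  rewrite -(gegfZ HJ) scalerAl mulX_gegP mulrDl (gegfD HJ) -scalerAl (gegfZ HJ) -expr2.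
  case: j {IH} => [|j]; first by rewrite mul0r (gegf0 HJ) addr0.
  by rewrite -scalerAl (gegfZ HJ) o mulr0 addr0.
have E2 : harmdim j.+1 * J ('X * P j * P j.+1) = rbin j * J (P j ^+ 2).
  rewrite -(gegfZ HJ) mulrAC scalerAl mulX_gegP mulrDl (gegfD HJ) -!scalerAl.
  by rewrite !(gegfZ HJ) -expr2 [P j.+2 * _]mulrC o mulr0 add0r.
have r0 := rbin_gt0 j; apply: (mulfI (lt0r_neq0 r0)).
by rewrite mulrCA -E1 mulrCA E2 mulrCA IH.
Qed.

(** The case m = l + 1, where both sides vanish, is needed for the last difference in
    [fejer_defect]. *)
Lemma J_fejer_gegP l m : (m <= l.+1)%N ->
  J (fejer l * P m) = (l.+1%:R - m%:R) * J 1.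
Proof.
rewrite leq_eqVlt => /orP[/eqP->|ml].
  rewrite subrr mul0r gegf_lower //.
  apply: leq_trans (size_sum _ _ _) _; apply/bigmax_leqP => i _.
  by rewrite (leq_trans (size_scale_leq _ _)) // (proj1 (size_gegP hD _)).
by rewrite (gegf_basis_mul HJ hD (fun j => (l.+1%:R - j%:R) * harmdim j)) // -mulrA gegP_normE.
Qed.

Lemma size_fejer l : (size (fejer l) <= l.+1)%N.
Proof.
apply: leq_trans (size_sum _ _ _) _; apply/bigmax_leqP => i _.
by rewrite (leq_trans (size_scale_leq _ _)) // (proj1 (size_gegP hD _)).
Qed.

(** The weights drop by 1 at each step, so the kernel pairs with every P_j - P_{j+1} to the same
    value J 1. *)
Lemma fejer_defect l :
  J ((1 - 'X) * fejer l ^+ 2) = J 1 * \sum_(j < l.+1) rbin j.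
Proof.
rewrite expr2 mulrA mul_1X_fejer mulr_suml (gegf_sum HJ) mulr_sumr.
apply: eq_bigr => i _; rewrite -scalerAl (gegfZ HJ) mulrC mulrBl (gegfB HJ).
rewrite ![P _ * _]mulrC !J_fejer_gegP ?ltn_ord //; last exact: ltnW.
by rewrite -(natr1 i); ring.
Qed.

Lemma fejer_norm l : J (fejer l ^+ 2) =
  J 1 * \sum_(j < l.+1) (l.+1%:R - j%:R) ^+ 2 * harmdim j.
Proof.
rewrite /fejer (gegf_sqr_basis HJ hD _ (fun j => (l.+1%:R - j%:R) * harmdim j)).
rewrite mulr_sumr; apply: eq_bigr => i _.
by rewrite -(gegP_normE i); ring.
Qed.

(** The partial sums of [rbin] have a closed form, the hockey-stick identity [G], and [harmdim] is a
    sum of two values of [rbin]. *)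
Lemma harmdim_sum_ge m : m%:R * harmdim m <= (D - 1) * \sum_(j < m.+1) harmdim j.
Proof.
have G k : (D - 1) * \sum_(j < k.+1) rbin j = (k%:R + D - 1) * rbin k.
  elim: k => [|k IH]; first by rewrite big_ord1 add0r.
  by rewrite big_ord_recr /= mulrDr IH -rbinS -natr1; ring.
have D2 := hD.
case: m => [|m]; first by rewrite mul0r mulr_ge0 ?sumr_ge0 //; [lra|move=> *; exact/ltW/harmdim_gt0].
have -> : \sum_(j < m.+2) harmdim j = \sum_(j < m.+2) rbin j + \sum_(j < m.+1) rbin j.
  rewrite big_ord_recl [in RHS]big_ord_recl -addrA -big_split /=.
  by rewrite /rbin big_ord0.
rewrite [leRHS]mulrDr !G /= -(natr1 m); have := rbin_gt0 m; have := rbin_gt0 m.+1.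
have m0 := ler0n R m; nra.
Qed.

(** A second summation of [harmdim_sum_ge]: it compares the increments of the two sides in l, and
    raises D - 1 to D. *)
Lemma harmdim_sum2_ge l :
  l%:R * \sum_(j < l.+1) harmdim j <= D * \sum_(j < l.+1) (l.+1%:R - j%:R) * harmdim j.
Proof.
have D2 := hD.
elim: l => [|l IH].
  rewrite mul0r mulr_ge0 ?sumr_ge0 //; first lra.
  move=> i _; rewrite mulr_ge0 ?(ltW (harmdim_gt0 _)) //.
  by rewrite subr_ge0 ler_nat ltnW.
have -> : \sum_(j < l.+2) (l.+2%:R - j%:R) * harmdim j =
    \sum_(j < l.+1) (l.+1%:R - j%:R) * harmdim j + \sum_(j < l.+2) harmdim j.
  rewrite !(@big_ord_recr _ _ _ l.+1) /= addrA -big_split /=.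
  congr (_ + _); last by rewrite -(natr1 l.+1); ring.
  by apply: eq_bigr => i _; rewrite -(natr1 l.+1); ring.
have := harmdim_sum_ge l.+1.
apply: contraTT; rewrite -!ltNge => h; move: IH h.
rewrite (@big_ord_recr _ _ _ l.+1) /= -(natr1 l).
set S := \sum_(j < l.+1) _; set T := \sum_(j < l.+1) _; set N := rbin _ + _ => IH h.
have N0 : 0 < N by exact: (harmdim_gt0 l.+1).
lra.
Qed.

(** With S, T, Q the sums of [harmdim] against the powers 0, 1, 2 of the weights, l S <= D T and T^2
    <= Q S give l^2 S <= D^2 Q, and S dominates the defect. *)
Lemma fejer_ratio l : l%:R ^+ 2 * J ((1 - 'X) * fejer l ^+ 2) <=
  D ^+ 2 * J (fejer l ^+ 2).
Proof.
have J1 := gegf_gt0 HJ.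
rewrite fejer_defect fejer_norm ![_ ^+ 2 * (J 1 * _)]mulrCA ler_pM2l //.
set S := \sum_(j < l.+1) harmdim j.
have S0 : 0 < S.
  rewrite /S big_ord_recl ltr_wpDr ?harmdim_gt0 //.
  by apply: sumr_ge0 => i _; apply/ltW/harmdim_gt0.
apply: (@le_trans _ _ (l%:R ^+ 2 * S)).
  by rewrite ler_wpM2l ?sqr_ge0 //; apply: ler_sum => i _; exact: rbin_le_harmdim.
rewrite -(ler_pM2r S0).
have := harmdim_sum2_ge l; rewrite -/S; set T := \sum_(j < _) _; set Q := \sum_(j < _) _.
move=> ST.
(* Cauchy-Schwarz, from the nonnegativity of the variance of the weights under [harmdim]. *)
have CS : T ^+ 2 <= Q * S.
  have : 0 <= \sum_(j < l.+1) (S * (l.+1%:R - j%:R) - T) ^+ 2 * harmdim j.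
    by apply: sumr_ge0 => i _; rewrite mulr_ge0 ?sqr_ge0 ?(ltW (harmdim_gt0 _)).
  have -> : \sum_(j < l.+1) (S * (l.+1%:R - j%:R) - T) ^+ 2 * harmdim j =
      S ^+ 2 * Q - 2 * S * T * T + T ^+ 2 * S.
    transitivity (\sum_(j < l.+1) S ^+ 2 * ((l.+1%:R - j%:R) ^+ 2 * harmdim j) -
        \sum_(j < l.+1) 2 * S * T * ((l.+1%:R - j%:R) * harmdim j) +
        \sum_(j < l.+1) T ^+ 2 * harmdim j); last by rewrite -!mulr_sumr.
    by rewrite -sumrB -big_split /=; apply: eq_bigr => i _; ring.
  have -> : S ^+ 2 * Q - 2 * S * T * T + T ^+ 2 * S = S * (Q * S - T ^+ 2) by ring.
  by rewrite pmulr_rge0 // subr_ge0.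
have l0 : 0 <= l%:R * S by rewrite mulr_ge0 ?ler0n // ltW.
have : (l%:R * S) ^+ 2 <= (D * T) ^+ 2 by rewrite ler_sqr ?nnegrE // (le_trans l0).
rewrite !exprMn => h; rewrite -mulrA -expr2; apply: le_trans h _.
by rewrite -[leRHS]mulrA ler_wpM2l ?sqr_ge0.
Qed.

Lemma fejer_norm_gt0 l : 0 < J (fejer l ^+ 2).
Proof.
rewrite fejer_norm mulr_gt0 ?(gegf_gt0 HJ) // big_ord_recl subr0.
rewrite ltr_wpDr ?mulr_gt0 ?exprn_gt0 ?ltr0n ?harmdim_gt0 //.
by apply: sumr_ge0 => i _; rewrite mulr_ge0 ?sqr_ge0 ?(ltW (harmdim_gt0 _)).
Qed.

End TestPolynomial.

(** * Integrals *)

Section ImproperIntegral.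
Variable R : realType.
Notation mu := (@lebesgue_measure R).

(** Meant for integrands that blow up at the ends, such as the arcsine density: the fundamental
    theorem on an exhaustion by compact intervals, then monotone convergence. *)
Lemma ge0_integral_oo_le (f F : R -> R) (a b M : R) : a < b ->
  {in `]a, b[, forall x, 0 <= f x} ->
  {in `]a, b[, continuous f} ->
  (forall x : R, x \in `]a, b[ -> is_derive x 1 F (f x)) ->
  {in `]a, b[, forall x, `|F x| <= M} ->
  measurable_fun `]a, b[ f ->
  (\int[mu]_(x in `]a, b[) (f x)%:E <= (2 * M)%:E)%E.
Proof.
move=> ab f0 cf dF FM mf.
(* The 3 makes the intervals nondegenerate already for n = 0. *)
pose e n : R := (b - a) / (n%:R + 3).
have e0 n : 0 < e n.
  by rewrite divr_gt0 ?subr_gt0 //; have := ler0n R n; lra.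
have e2 n : 2 * e n < b - a.
  rewrite /e mulrCA gtr_pMr ?subr_gt0 // ltr_pdivrMr; have := ler0n R n; lra.
have emono n m : (n <= m)%N -> e m <= e n.
  move=> nm; apply: ler_wpM2l; first by rewrite subr_ge0 ltW.
  have n0 := ler0n R n; have m0 := ler0n R m.
  by rewrite lef_pV2 ?posrE ?lerD2r ?ler_nat //; lra.
pose A n : set R := [set` `[a + e n, b - e n]].
have sA n : A n `<=` `]a, b[.
  move=> x; rewrite /A /= !in_itv /= => /andP[h1 h2].
  by have en := e0 n; apply/andP; split; lra.
have UA : \bigcup_n A n = [set` `]a, b[].
  apply/seteqP; split=> [x [n _]|x]; first exact: sA.
  rewrite /= in_itv /= => /andP[ax xb].
  have [n hn] : exists n, e n <= Num.min (x - a) (b - x).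
    set m := Num.min _ _; have m0 : 0 < m by rewrite lt_min !subr_gt0 ax.
    exists (Num.truncn ((b - a) / m)).
    rewrite /e ler_pdivrMr; last by have := ler0n R (Num.truncn ((b - a) / m)); lra.
    rewrite -ler_pdivrMl // mulrC.
    have := truncnS_gt ((b - a) / m); rewrite -natr1; lra.
  exists n => //; rewrite /A /= in_itv /=.
  by move: hn; rewrite le_min => /andP[h1 h2]; apply/andP; split; lra.
have ndA : nondecreasing_seq A.
  move=> n m nm; apply/subsetPset => x; rewrite /A /= !in_itv /= => /andP[h1 h2].
  by have em := emono _ _ nm; apply/andP; split; lra.
have fA0 i x : A i x -> (0 <= (EFin \o f) x)%E.
  by move=> /sA Ax; rewrite lee_fin f0.
have mfA i : measurable_fun (A i) f.
  by apply: measurable_funS mf => //; exact: sA.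
have cv := @ge0_nondecreasing_set_cvg_integral _ (measurableTypeR R) R A
  (EFin \o f) mu ndA (fun i => measurable_itv _)
  (fun i => (measurable_EFinP _ _).2 (mfA i)) fA0.
rewrite UA in cv.
rewrite -(cvg_lim _ cv) //; apply: lime_le; first by apply/cvg_ex; eexists; exact: cv.
apply: nearW => n.
have abn : a + e n < b - e n by have := e2 n; lra.
have inA x : x \in `[a + e n, b - e n] -> x \in `]a, b[.
  by have en := e0 n; rewrite !in_itv /= => /andP[? ?]; apply/andP; split; lra.
have ca x : x \in `]a, b[ -> {for x, continuous F}.
  move=> xab; have [dx _] := dF _ xab.
  by apply/differentiable_continuous/derivable1_diffP.
rewrite (@continuous_FTC2 _ f F) //.
- rewrite lee_fin.
  have h1 : `|F (b - e n)| <= M by rewrite FM // inA // in_itv /= lexx ltW.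
  have h2 : `|F (a + e n)| <= M by rewrite FM // inA // in_itv /= lexx ltW.
  apply: le_trans (ler_norm _) _; apply: le_trans (ler_normB _ _) _.
  by rewrite mulr_natl mulr2n lerD.
- apply: continuous_in_subspaceT => x; rewrite inE => xA; apply: cf.
  exact: inA.
- split.
  + by move=> x xA; apply: (@ex_derive _ _ _ _ _ _ _ (dF _ _)); apply: inA; exact: subset_itv_oo_cc.
  + by apply: cvg_at_right_filter; apply: ca; rewrite inA // in_itv /= lexx ltW.
  + by apply: cvg_at_left_filter; apply: ca; rewrite inA // in_itv /= lexx ltW.
- move=> x xA; rewrite derive1E; have := dF x (inA _ (subset_itv_oo_cc xA)).
  by move=> ?; rewrite derive_val.
Qed.

(** Here f may be singular at the endpoints. The indefinite integral of f and F have the same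
    derivative inside and are continuous up to the ends, so the mean value theorem makes their
    difference constant. *)
Lemma Rintegral_FTC2 (f F : R -> R) (a b : R) : a < b ->
  mu.-integrable `[a, b] (EFin \o f) ->
  {in `]a, b[, continuous f} ->
  (forall x : R, x \in `]a, b[ -> is_derive x 1 F (f x)) ->
  {within `[a, b], continuous F} ->
  \int[mu]_(x in `[a, b]) f x = F b - F a.
Proof.
move=> ab fi cf dF cF.
pose G x := parameterized_integral mu a x f.
have cG : {within `[a, b], continuous G} by apply: parameterized_integral_continuous; rewrite ?ltW.
have dG x : x \in `]a, b[ -> is_derive x 1 G (f x).
  move=> xab; have [ax xb] : a < x /\ x < b by move: xab; rewrite in_itv /= => /andP[].
  have [d1 d2] := continuous_FTC1_closed xb fi ax (cf _ xab).
  by apply: DeriveDef; [exact: d1|rewrite -d2 derive1E].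
have dGF x : x \in `]a, b[ -> is_derive x 1 (G - F) 0.
  by move=> xab; rewrite -[0](subrr (f x)); apply: is_deriveB; [exact: dG|exact: dF].
have cGF : {within `[a, b], continuous (G - F)}.
  by move=> x; apply: continuousB; [exact: cG|exact: cF].
have [c cab] := @MVT _ (G - F) (fun=> 0) a b ab dGF cGF.
rewrite mul0r => e.
have Ga : G a = 0 by rewrite /G /parameterized_integral set_itv1 Rintegral_set1.
have : G b - F b - (G a - F a) = 0 := e.
rewrite Ga /G /parameterized_integral; lra.
Qed.

End ImproperIntegral.

(** * Integrability and moments of the Gegenbauer weight *)

Section GegenbauerWeight.
Variables (R : realType) (d : nat).
Notation mu := (@lebesgue_measure R).
Local Notation wt := (fun t : R => (1 - t ^+ 2) `^ ((d%:R - 3) / 2)).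

Lemma in_unit_itv (t : R) : (t \in `]-1, 1[) = (0 < 1 - t ^+ 2).
Proof. by rewrite in_itv /= -ltr_norml subr_gt0 -real_normK ?num_real // expr_lt1. Qed.

Lemma gegenbauer_wtE (hd : (2 <= d)%N) (t : R) : t \in `]-1, 1[ ->
  wt t = Num.sqrt (1 - t ^+ 2) ^+ (d - 2) / Num.sqrt (1 - t ^+ 2).
Proof.
rewrite in_unit_itv => t0; have t1 := ltW t0; rewrite -[in RHS](powR12_sqrt t1).
rewrite -[X in _ = X / _]powR_mulrn ?powR_ge0 // -powRrM -powRB; last first.
  by rewrite (gt_eqF t0) implybT.
by congr powR; rewrite natrB //; field.
Qed.

Lemma measurable_wt (D : set R) : measurable D -> measurable_fun D wt.
Proof.
move=> mD; apply: measurable_funTS.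
apply: (measurableT_comp (measurable_powR _)).
by apply: measurable_funB => //; apply: measurable_funX.
Qed.

Lemma continuous_wt (hd : (2 <= d)%N) : {in `]-1, 1[, continuous wt}.
Proof.
move=> t tI; have t0 := tI; rewrite in_unit_itv in t0.
apply: (@continuous_comp R R R (fun t : R => 1 - t ^+ 2) (fun x : R => x `^ ((d%:R - 3) / 2))) => /=.
  apply: continuousB; first exact: cst_continuous.
  exact: exprn_continuous.
by apply/differentiable_continuous/derivable1_diffP/derivable_powR; rewrite in_itv /= t0.
Qed.

(** For d = 2 the weight is the unbounded derivative of arcsine; from d = 3 on it is at most 1. *)
Lemma integrable_wt (hd : (2 <= d)%N) : mu.-integrable `[-1, 1] (EFin \o wt).
Proof.
have [d2|d3] := leqP d 2.
  have d2E : d = 2%N by apply/eqP; rewrite eqn_leq d2.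
  apply/integrableP; split; first by apply/measurable_EFinP; exact: measurable_wt.
  under eq_integral do rewrite /= ger0_norm ?powR_ge0 //.
  rewrite integral_itv_bndoo; last by apply/measurable_EFinP; exact: measurable_wt.
  apply: le_lt_trans (ltry (2 * (pi / 2))).
  apply: (@ge0_integral_oo_le _ _ asin) => //.
  - by move=> x _; exact: powR_ge0.
  - exact: continuous_wt.
  - move=> x xI; rewrite gegenbauer_wtE // d2E expr0 div1r.
    by apply: is_derive1_asin; move: xI; rewrite in_itv.
  - move=> x; rewrite in_itv /= => /andP[x1 x2].
    have xI : -1 <= x <= 1 by rewrite !ltW.
    by rewrite ler_norml asin_geNpi2 // asin_lepi2.
  - exact: measurable_wt.
apply: measurable_bounded_integrable => //.
- by rewrite /= lebesgue_measure_itv /= lte_fin gtrN // -EFinB ltry.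
- exact: measurable_wt.
- exists 1; split; first exact: num_real.
  move=> M M1 t /=; rewrite in_itv /= => /andP[t1 t2].
  rewrite ger0_norm ?powR_ge0 //; apply: le_trans (ltW M1).
  apply: (@le_trans _ _ (1 `^ ((d%:R - 3) / 2))); last by rewrite powR1.
  apply: ge0_ler_powR; rewrite ?nnegrE //.
  + by rewrite divr_ge0 // subr_ge0 ler_nat.
  + by rewrite subr_ge0; nra.
  + by rewrite lerBlDl ler_wpDl // sqr_ge0.
Qed.

Lemma integrable_poly_wt (hd : (2 <= d)%N) (p : {poly R}) :
  mu.-integrable `[-1, 1] (EFin \o (fun t => p.[t] * wt t)).
Proof.
apply: (@integrableMr _ _ _ mu _ _ (horner p) (EFin \o wt)) => //.
- by apply: measurable_funTS; apply: continuous_measurable_fun; exact: continuous_horner.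
- exists (\sum_(i < size p) `|p`_i|); split; first exact: num_real.
  move=> M /ltW pM t /=; rewrite in_itv /= => tI; apply: le_trans pM.
  rewrite horner_coef; apply: le_trans (ler_norm_sum _ _ _) _.
  apply: ler_sum => i _; rewrite normrM ler_piMr // normrX exprn_ile1 //.
  by rewrite ler_norml.
- exact: integrable_wt.
Qed.

Lemma gegenbauer_int_linear (hd : (2 <= d)%N) a (p q : {poly R}) :
  gegenbauer_int d (a *: p + q) = a * gegenbauer_int d p + gegenbauer_int d q.
Proof.
have ip := integrable_poly_wt hd p; have iq := integrable_poly_wt hd q.
rewrite /gegenbauer_int -RintegralZl // -RintegralD //; last first.
  apply: eq_integrable (integrable_poly_wt hd (a *: p)) => // t _.
  by rewrite /= hornerZ mulrA.
by apply: eq_Rintegral => t _; rewrite hornerD hornerZ mulrDl mulrA.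
Qed.

Lemma le_gegenbauer_int (hd : (2 <= d)%N) (p q : {poly R}) :
  (forall t, -1 <= t <= 1 -> p.[t] <= q.[t]) ->
  gegenbauer_int d p <= gegenbauer_int d q.
Proof.
move=> pq; apply: le_Rintegral => //; try exact: integrable_poly_wt.
by move=> t /=; rewrite in_itv /= => tI; rewrite ler_wpM2r ?powR_ge0 ?pq.
Qed.

Lemma gegenbauer_int1_gt0 (hd : (2 <= d)%N) : 0 < gegenbauer_int d (1 : {poly R}).
Proof.
have sI : [set` `[-(2^-1), 2^-1 : R]] `<=` [set` `[-1, 1 : R]].
  by move=> t /=; rewrite !in_itv /= => /andP[? ?]; apply/andP; split; lra.
rewrite /gegenbauer_int; under eq_Rintegral do rewrite hornerC mul1r.
have iw := integrable_wt hd.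
rewrite fine_gt0 //; apply/andP; split; last first.
  by rewrite ltey_eq integrable_fin_num.
have h : (0 < \int[mu]_(t in `[(- 2^-1)%R, (2^-1)%R]) ((3 / 4) ^+ d)%:E)%E.
  rewrite integral_cst //= lebesgue_measure_itv /= lte_fin.
  have -> : (- (2^-1) < 2^-1 :> R) by lra.
  by rewrite -EFinB -EFinM lte_fin mulr_gt0 ?exprn_gt0 //; lra.
apply: (lt_le_trans h _); apply: (@le_trans _ _ (\int[mu]_(t in `[(- 2^-1)%R, (2^-1)%R]) (wt t)%:E)%E).
  apply: ge0_le_integral => //.
  - by apply/measurable_EFinP; exact: measurable_wt.
  move=> t; rewrite /= in_itv /= => /andP[t1 t2]; rewrite lee_fin.
  have t3 : 3 / 4 <= 1 - t ^+ 2 by nra.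
  have t4 : 1 - t ^+ 2 <= 1 by rewrite lerBlDl ler_wpDl // sqr_ge0.
  (* The base lies in [3/4, 1], so raising the exponent (d - 3) / 2 to d only lowers the power. *)
  apply: (@le_trans _ _ ((1 - t ^+ 2) `^ d%:R)).
    by rewrite powR_mulrn ?lerXn2r ?nnegrE //; lra.
  apply: ger_powR; first by apply/andP; split; lra.
  by have := ler0n R d; lra.
apply: ge0_subset_integral => //.
- by apply/measurable_EFinP; exact: measurable_wt.
- by move=> t _; rewrite lee_fin powR_ge0.
Qed.

(** The integrand is the derivative of p(t) (1 - t^2)^((d-1)/2), which vanishes at both ends. The
    cases p = 1 and p = t^(m+1) give the moment recursion. *)
Lemma gegenbauer_int_deriv (hd : (2 <= d)%N) (p : {poly R}) :
  gegenbauer_int d (p^`() * (1 - 'X^2) - (d.-1)%:R *: (p * 'X)) = 0.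
Proof.
pose F (t : R) := p.[t] * Num.sqrt (1 - t ^+ 2) ^+ d.-1.
have F1 t : t ^+ 2 = 1 -> F t = 0.
  by move=> t1; rewrite /F t1 subrr sqrtr0 expr0n; case: d hd => [|[|?]] //= _; rewrite mulr0.
transitivity (F 1 - F (-1)); last by rewrite !F1 ?subrr // ?sqrrN expr1n.
apply: Rintegral_FTC2.
- lra.
- exact: integrable_poly_wt.
- move=> t tI; apply: continuousM; first exact: continuous_horner.
  exact: continuous_wt.
- move=> t tI; have t0 := tI; rewrite in_unit_itv in t0.
  rewrite gegenbauer_wtE //.
  have s0 : 0 < Num.sqrt (1 - t ^+ 2) by rewrite sqrtr_gt0.
  have dS : is_derive t 1 (fun t : R => 1 - t ^+ 2) (- (2 * t)).
    apply: is_derive_eq; rewrite /= !scaler1; ring.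
  have dQ : is_derive t 1 (fun t : R => Num.sqrt (1 - t ^+ 2))
      ((2 * Num.sqrt (1 - t ^+ 2))^-1 * (- (2 * t))).
    exact: (@is_derive1_comp R Num.sqrt (fun t => 1 - t ^+ 2) t _ _ (is_derive1_sqrt t0) dS).
  have := is_deriveM (is_derive_poly p t) (is_deriveX d.-1 dQ).
  have -> : F = horner p * (fun t : R => Num.sqrt (1 - t ^+ 2)) ^+ d.-1.
    by apply/funext => x; rewrite /F !fctE.
  move=> h; apply: (is_derive_eq h) => {h}.
  have e2 : Num.sqrt (1 - t ^+ 2) ^+ 2 = 1 - t ^+ 2 by rewrite sqr_sqrtr ?ltW.
  rewrite !(hornerD, hornerN, hornerZ, hornerM, hornerX, hornerXn, hornerC) fctE.
  rewrite /GRing.scale /=; move: s0 e2 {dQ dS}.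
  set s : R := Num.sqrt _; move: s => s s0 e2; rewrite -e2.
  case: d hd => [|[|n]] //= _; rewrite subSS subn1 /=.
  by rewrite exprS; field; exact: lt0r_neq0.
- apply: continuous_subspaceT => t.
  apply: continuousM; first exact: continuous_horner.
  have -> : (fun t : R => Num.sqrt (1 - t ^+ 2) ^+ d.-1) =
      (fun x => x ^+ d.-1) \o (Num.sqrt \o (fun t : R => 1 - t ^+ 2)) by [].
  apply: continuous_comp; last exact: exprn_continuous.
  apply: continuous_comp; last exact: sqrt_continuous.
  by apply: continuousB; [exact: cst_continuous|exact: exprn_continuous].
Qed.

Lemma gegenbauer_int_functional (hd : (2 <= d)%N) :
  gegenbauer_functional d%:R (gegenbauer_int d : {poly R} -> R).
Proof.
have L := gegenbauer_int_linear hd.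
have D1 : d%:R = d.-1%:R + 1 :> R by rewrite natr1 prednK // ltnW.
have L0 : gegenbauer_int d (0 : {poly R}) = 0.
  by apply: (@addrI _ (gegenbauer_int d 0)); rewrite -{1}[gegenbauer_int d 0]mul1r -L scale1r !addr0.
have LZ (a : R) (p : {poly R}) : gegenbauer_int d (a *: p) = a * gegenbauer_int d p.
  by rewrite -[a *: p]addr0 L L0 addr0.
split => //; first exact: gegenbauer_int1_gt0.
  have d1 : d.-1 != 0%N by rewrite -lt0n -ltnS prednK // ltnW.
  have := gegenbauer_int_deriv hd 1.
  rewrite derivC mul0r sub0r mul1r -scaleNr LZ => /eqP.
  by rewrite mulf_eq0 oppr_eq0 pnatr_eq0 (negPf d1) => /eqP.
move=> m; have := gegenbauer_int_deriv hd 'X^(m.+1).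
have -> : ('X^(m.+1))^`() * (1 - 'X^2) - d.-1%:R *: ('X^(m.+1) * 'X) =
    (m%:R + 1) *: 'X^m + (- (m%:R + d%:R)) *: 'X^(m.+2) :> {poly R}.
  have e1 : 'X^m * 'X^2 = 'X^(m.+2) :> {poly R} by rewrite -exprD addn2.
  rewrite derivXn -pred_Sn mulrnAl mulrBr mulr1 e1 -exprSr -[_ *+ m.+1]scaler_nat.
  rewrite D1 scalerBr -addrA -opprD -scalerDl -scaleNr -(natr1 m).
  by congr (_ *: _ + _ *: _); lra.
by rewrite L LZ; lra.
Qed.

End GegenbauerWeight.

(** * Finiteness and positivity of the sphere area *)

Section SphereArea.
Variable R : realType.
Notation mu := (@lebesgue_measure R).

(* The integral defining [sphere_area], over the ball of squared radius s: a
   slice of this ball is again such a ball. *)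
Definition cap_integral (m : nat) (s : R) : \bar R :=
  integral_rV (fun y : 'rV[R]_m =>
    (if sqnorm y < s then (Num.sqrt (s - sqnorm y))^-1 else 0)%:E).

Lemma cap_integral0 s :
  cap_integral 0 s = (if 0 < s then (Num.sqrt s)^-1 else 0)%:E.
Proof. by rewrite /cap_integral /= /sqnorm big_ord0 subr0. Qed.

Lemma cap_integralS m s :
  cap_integral m.+1 s = (\int[mu]_(t in [set: R]) cap_integral m (s - t ^+ 2))%E.
Proof.
apply: eq_integral => t _; congr integral_rV; apply/funext => y.
have -> : sqnorm (row_mx (t%:M : 'M[R]_1) y) = t ^+ 2 + sqnorm y.
  rewrite /sqnorm big_split_ord big_ord1 /= row_mxEl mxE eqxx mulr1n.
  by congr (_ + _); apply: eq_bigr => i _; rewrite row_mxEr.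
by rewrite ltrBrDl opprD addrA.
Qed.

Lemma cap_integral_ge0 m s : (0 <= cap_integral m s)%E.
Proof.
elim: m s => [|m IH] s.
  by rewrite cap_integral0 lee_fin; case: ifP => // _; rewrite invr_ge0 sqrtr_ge0.
by rewrite cap_integralS integral_ge0.
Qed.

Lemma cap_integral_eq0 m s : s <= 0 -> cap_integral m s = 0%E.
Proof.
elim: m s => [|m IH] s s0; first by rewrite cap_integral0 ltNge s0.
rewrite cap_integralS integral0_eq // => t _; apply: IH.
by rewrite lerBlDr (le_trans s0) // add0r sqr_ge0.
Qed.

Lemma measurable_cap_integral m :
  measurable_fun [set: measurableTypeR R] (cap_integral m).
Proof.
elim: m => [|m IH].
  rewrite (_ : cap_integral 0 = EFin \o (fun s => if 0 < s then s `^ (- 2^-1) else 0)).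
    apply/measurable_EFinP; apply: measurable_fun_ifT => //.
    exact: measurable_fun_ltr.
  apply/funext => s; rewrite cap_integral0 /=; congr EFin; case: ifP => // s0.
  by rewrite powRN powR12_sqrt // ltW.
rewrite (_ : cap_integral m.+1 = fun s => (\int[mu]_(t in [set: R]) cap_integral m (s - t ^+ 2))%E); last first.
  by apply/funext => s; rewrite cap_integralS.
apply: (measurable_fun_fubini_tonelli_F (m2 := mu)
  (fun p : measurableTypeR R * measurableTypeR R => cap_integral m (p.1 - p.2 ^+ 2))).
  apply: (measurableT_comp IH).
  by apply: measurable_funB => //; apply: measurable_funX.
by move=> p; exact: cap_integral_ge0.
Qed.

(** For |t| <= s/2 and s <= 1 the slice has squared radius at least 3s/4; integrating over this
    interval of length s gains one power of s. *)
Lemma cap_integral_lower m : exists2 c : R, 0 < c &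
  forall s : R, 0 < s <= 1 -> ((c * s ^+ m)%:E <= cap_integral m s)%E.
Proof.
elim: m => [|m [c c0 IH]].
  exists 1 => // s /andP[s0 s1]; rewrite expr0 mulr1 cap_integral0 s0 lee_fin.
  rewrite invf_ge1 ?sqrtr_gt0 // -[leRHS]sqrtr1; exact: ler_wsqrtr.
exists (c * (3 / 4) ^+ m); first by rewrite mulr_gt0 ?exprn_gt0 //; lra.
move=> s /andP[s0 s1]; rewrite cap_integralS.
apply: (@le_trans _ _ (\int[mu]_(t in `[(- (s / 2))%R, (s / 2)%R]) (c * (3 / 4 * s) ^+ m)%:E)%E).
  rewrite integral_cst //= lebesgue_measure_itv /= lte_fin.
  have -> : (- (s / 2) < s / 2) by lra.
  rewrite -EFinB -EFinM lee_fin [(3 / 4 * s) ^+ m]exprMn exprSr le_eqVlt; apply/orP; left.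
  by apply/eqP; field.
apply: (@le_trans _ _ (\int[mu]_(t in `[(- (s / 2))%R, (s / 2)%R]) cap_integral m (s - t ^+ 2))%E).
  apply: ge0_le_integral => //.
  - by move=> t _; rewrite lee_fin mulr_ge0 ?exprn_ge0 ?ltW //; lra.
  - apply: measurable_funTS; apply: (measurableT_comp (measurable_cap_integral m)).
    by apply: measurable_funB => //; apply: measurable_funX.
  move=> t /=; rewrite in_itv /= => /andP[t1 t2].
  have t3 : t ^+ 2 <= s / 4 by nra.
  have t4 := sqr_ge0 t.
  apply: le_trans (IH (s - t ^+ 2) _); last by apply/andP; split; lra.
  rewrite lee_fin ler_pM2l // lerXn2r ?nnegrE //; lra.
apply: ge0_subset_integral => //.
  apply: (measurableT_comp (measurable_cap_integral m)).
  by apply: measurable_funB => //; apply: measurable_funX.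
by move=> t _; exact: cap_integral_ge0.
Qed.

(** In dimension 0 the integral is s^(-1/2), unbounded near 0; one integration, an arcsine, already
    removes the singularity, hence the start at dimension 1. *)
Lemma cap_integral_upper m : exists K : R,
  forall s : R, 0 < s <= 1 -> (cap_integral m.+1 s <= K%:E)%E.
Proof.
elim: m => [|m [K IH]].
  exists (2 * (pi / 2)) => s /andP[s0 s1]; rewrite cap_integralS.
  pose r := Num.sqrt s; have r0 : 0 < r by rewrite sqrtr_gt0.
  have r2 : r ^+ 2 = s by rewrite sqr_sqrtr // ltW.
  have inr t : (t \in `]-r, r[) = (0 < s - t ^+ 2).
    rewrite in_itv /= -ltr_norml subr_gt0 -r2 -[t ^+ 2]real_normK ?num_real //.
    by rewrite ltr_sqr ?nnegrE // ltW.
  pose f t := (s - t ^+ 2) `^ (- 2^-1).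
  have mf D : measurable D -> measurable_fun D f.
    move=> mD; apply: measurable_funTS; apply: (measurableT_comp (measurable_powR _)).
    by apply: measurable_funB => //; apply: measurable_funX.
  rewrite [leLHS](_ : _ = \int[mu]_(t in `](- r)%R, r[) (f t)%:E)%E; last first.
    rewrite [RHS]integral_mkcond; apply: eq_integral => t _; rewrite patchE mem_setE.
    rewrite cap_integral0 inr; case: ifP => // t0.
    by rewrite /f powRN powR12_sqrt // ltW.
  apply: (@ge0_integral_oo_le _ f (fun t => asin (t / r))).
  - by rewrite gtrN.
  - by move=> t _; exact: powR_ge0.
  - move=> t; rewrite inr => t0.
    apply: (@continuous_comp R R R (fun t : R => s - t ^+ 2) (fun x : R => x `^ (- 2^-1))) => /=.
      by apply: continuousB; [exact: cst_continuous|exact: exprn_continuous].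
    by apply/differentiable_continuous/derivable1_diffP/derivable_powR; rewrite in_itv /= t0.
  - move=> t tI; have t0 := tI; rewrite inr in t0.
    have tr : -1 < t / r < 1.
      by rewrite ltr_pdivrMr // ltr_pdivlMr // mulN1r mul1r; move: tI; rewrite in_itv.
    have := @is_derive1_comp R asin (fun t => t / r) t _ r^-1 (is_derive1_asin tr).
    have dr : is_derive t 1 (fun t : R => t / r) r^-1.
      have := is_deriveM (is_derive_id t (1 : R)) (is_derive_cst (r^-1) t (1 : R)).
      by move=> h; apply: (is_derive_eq h); rewrite /= scaler0 add0r scaler1.
    move=> /(_ dr) h; apply: (is_derive_eq h).
    rewrite /f powRN powR12_sqrt ?ltW // -invfM; congr (_^-1).
    rewrite -[in LHS]/r -[X in _ * X](ger0_norm (ltW r0)) -sqrtr_sqr -sqrtrM.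
      by congr Num.sqrt; rewrite -r2; field; exact: lt0r_neq0.
    rewrite -ltr_norml in tr; rewrite subr_ge0 -real_normK ?num_real //.
    by rewrite expr_le1 // ltW.
  - move=> t tI; have tr : -1 <= t / r <= 1.
      rewrite ler_pdivrMr // ler_pdivlMr // mulN1r mul1r; move: tI; rewrite in_itv.
      by move=> /andP[? ?]; rewrite !ltW.
    by rewrite ler_norml asin_geNpi2 // asin_lepi2.
  - exact: mf.
exists (K * 2) => s /andP[s0 s1]; rewrite cap_integralS.
have K0 : 0 <= K.
  rewrite -lee_fin (le_trans (cap_integral_ge0 m.+1 1)) // IH //; lra.
rewrite [leLHS](_ : _ = \int[mu]_(t in `[(-1)%R, 1%R]) cap_integral m.+1 (s - t ^+ 2))%E; last first.
  rewrite [RHS]integral_mkcond; apply: eq_integral => t _; rewrite patchE.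
  case: ifPn => // tI; apply: cap_integral_eq0.
  move: tI; rewrite notin_setE /= in_itv /= => /negP; rewrite negb_and -!ltNge.
  by case/orP => h; nra.
apply: (@le_trans _ _ (\int[mu]_(t in `[(-1)%R, 1%R]) K%:E)%E); last first.
  rewrite integral_cst //= lebesgue_measure_itv /= lte_fin.
  have -> : (-1 < 1 :> R) by lra.
  by rewrite -EFinB -EFinM lee_fin; lra.
apply: ge0_le_integral => //.
- by move=> t _; exact: cap_integral_ge0.
- apply: measurable_funTS; apply: (measurableT_comp (measurable_cap_integral m.+1)).
  by apply: measurable_funB => //; apply: measurable_funX.
- move=> t _; have [st|st] := leP (s - t ^+ 2) 0.
    by rewrite cap_integral_eq0 // lee_fin.
  by apply: IH; rewrite st /= lerBlDr ler_wpDr // sqr_ge0.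
Qed.

(** As [fine] sends +oo to 0, positivity requires both the lower and the upper bound. *)
Lemma sphere_area_gt0 d : 0 < sphere_area R d.
Proof.
rewrite /sphere_area mulr_gt0 // -/(cap_integral d.-1 1) fine_gt0 //.
have [c c0 h] := cap_integral_lower d.-1.
have /h h1 : (0 < (1 : R) <= 1) by rewrite ltr01 lexx.
apply/andP; split; first by apply: lt_le_trans h1; rewrite lte_fin expr1n mulr1.
case: d.-1 => [|m]; first by rewrite cap_integral0 ltry.
have [K hK] := cap_integral_upper m.
by apply: le_lt_trans (hK 1 _) (ltry _); rewrite ltr01 lexx.
Qed.

End SphereArea.

(** * Gegenbauer coefficients of squares and upper bounds on rho *)

Section GegenbauerCoefficients.
Variables (R : realType) (d : nat).
Hypothesis hd : (2 <= d)%N.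
Local Notation J := (gegenbauer_int d : {poly R} -> R).
Local Notation P := (gegP (d%:R : R)).
Local Notation c := (sphere_area R d.-1 / sphere_area R d).

Let hD : 2 <= d%:R :> R. Proof. by rewrite ler_nat. Qed.
Let HJ := @gegenbauer_int_functional R d hd.

Lemma area_ratio_gt0 : 0 < c.
Proof. by rewrite divr_gt0 ?sphere_area_gt0. Qed.

Lemma is_gegenbauer_exists : exists C : nat -> {poly R}, is_gegenbauer d C.
Proof.
(* The normalization asks for k^2 J(P_i^2) = k / c. *)
pose k i := (c * J (P i ^+ 2))^-1.
have k0 i : 0 < k i by rewrite invr_gt0 mulr_gt0 ?area_ratio_gt0 ?(gegP_norm_gt0 HJ).
exists (fun i => k i *: P i); split.
- by move=> i; rewrite size_scale ?(proj1 (size_gegP hD i)) // lt0r_neq0.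
- move=> i j /eqP ij; rewrite -scalerAl -scalerAr !(gegfZ HJ) (gegP_orth HJ) //.
  by rewrite !mulr0.
- by move=> i; rewrite hornerZ gegP_horner1 // mulr1.
- move=> i; rewrite exprZn (gegfZ HJ) hornerZ gegP_horner1 // mulr1 /k.
  have := gegP_norm_gt0 HJ hD i; set N := gegenbauer_int d _ => N0.
  have a0 := sphere_area_gt0 R d; have b0 := sphere_area_gt0 R d.-1.
  by field; rewrite !lt0r_neq0.
Qed.

Lemma gegenbauer_gegP i : (gegenbauer R d i).[1]^-1 *: gegenbauer R d i = P i.
Proof.
have [sC oC pC _] : is_gegenbauer d (gegenbauer R d).
  by apply: (@xgetPex _ (fun=> 0) [set C | is_gegenbauer d C]); exact: is_gegenbauer_exists.
exact: (orthogonal_gegP HJ hD sC oC pC).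
Qed.

Lemma gegenbauer_coefE (phi : {poly R}) i :
  gegenbauer_coef d phi i = c * J (phi * P i).
Proof. by rewrite /gegenbauer_coef gegenbauer_gegP. Qed.

Lemma gegenbauer_coef_near (q : {poly R}) i :
  gegenbauer_coef d (q ^+ 2) 0%N = 1 ->
  `|1 - gegenbauer_coef d (q ^+ 2) i| <=
    3 ^+ i * (i.+1 * i.+1)%N%:R * (c * J ((1 - 'X) * q ^+ 2)).
Proof.
rewrite !gegenbauer_coefE gegP0 mulr1 => h.
have -> : 1 - c * J (q ^+ 2 * P i) = c * J (q ^+ 2 - q ^+ 2 * P i).
  by rewrite (gegfB HJ) mulrBr h.
rewrite normrM gtr0_norm ?area_ratio_gt0 // [leRHS]mulrCA ler_pM2l ?area_ratio_gt0 //.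
have gN p : J (- p) = - J p by rewrite -scaleN1r (gegfZ HJ) mulN1r.
rewrite -(gegfZ HJ) ler_norml -gN.
have key t : -1 <= t <= 1 -> `|(q ^+ 2 - q ^+ 2 * P i).[t]| <=
    ((3 ^+ i * (i.+1 * i.+1)%N%:R) *: ((1 - 'X) * q ^+ 2)).[t].
  move=> tI; rewrite !(hornerD, hornerN, hornerZ, hornerM, hornerX, hornerC) -!expr2.
  rewrite -{1}[X in `|X - _|]mulr1 -mulrBr normrM ger0_norm ?sqr_ge0 //.
  rewrite [leRHS]mulrA [leRHS]mulrC ler_wpM2l ?sqr_ge0 //; exact: gegP_near1.
apply/andP; split; apply: le_gegenbauer_int => // t /key.
  by rewrite ler_norml hornerN => /andP[].
by apply: le_trans; exact: ler_norm.
Qed.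

(** The smallness condition forces every lambda_{2k} to be at least 1/2, whence |1/lambda - 1| <= 2
    |1 - lambda|. *)
Lemma rho_le n l (e : R) (q : {poly R}) : (size q <= l.+1)%N ->
  gegenbauer_coef d (q ^+ 2) 0%N = 1 ->
  c * J ((1 - 'X) * q ^+ 2) <= e ->
  3 ^+ (2 * n) * ((2 * n).+1 * (2 * n).+1)%N%:R * e <= 2^-1 ->
  (rho R n d l <= (n%:R * (2 * (3 ^+ (2 * n) * ((2 * n).+1 * (2 * n).+1)%N%:R)) * e)%:E)%E.
Proof.
set K := 3 ^+ (2 * n) * _ => sq q0 qe Ke.
have K0 : 0 <= K by rewrite mulr_ge0 ?exprn_ge0 ?ler0n.
have c0 := area_ratio_gt0.
have q1 : 0 <= c * J ((1 - 'X) * q ^+ 2).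
  rewrite mulr_ge0 ?(ltW c0) // -(gegf0 HJ); apply: le_gegenbauer_int => // t /andP[_ t1].
  rewrite horner0 hornerM mulr_ge0 //; last by rewrite horner_exp sqr_ge0.
  by rewrite !(hornerD, hornerN, hornerX, hornerC) subr_ge0.
apply: le_trans (ereal_inf_lbound _) _.
  by exists q; [split|reflexivity].
have -> : (n%:R * (2 * K) * e)%:E = (\sum_(1 <= k < n.+1) (2 * K * e)%:E)%E.
  rewrite sumEFin big_const_nat iter_addr_0 subn1 /= -mulr_natl.
  by congr EFin; ring.
rewrite !big_seq; apply: lee_sum => k; rewrite mem_index_iota => /andP[k1 kn].
have kle : `|1 - gegenbauer_coef d (q ^+ 2) (2 * k)%N| <= K * e.
  apply: le_trans (gegenbauer_coef_near _ q0) _; apply: ler_pM => //.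
  have kn2 : (2 * k <= 2 * n)%N by rewrite leq_mul2l.
  apply: ler_pM; rewrite ?exprn_ge0 ?ler0n //.
    by rewrite ler_weXn2l // ler1n.
  by rewrite ler_nat leq_mul.
set a := gegenbauer_coef _ _ _ in kle *.
have a2 : 2^-1 <= a.
  have := le_trans (ler_norm _) kle; have := Ke; lra.
rewrite /inv_deviation gt_eqF; last by apply: lt_le_trans a2; rewrite invr_gt0.
have a0 : 0 < a by apply: lt_le_trans a2; rewrite invr_gt0.
rewrite lee_fin.
have -> : a^-1 - 1 = (1 - a) / a by field; exact: lt0r_neq0.
rewrite normrM normfV (gtr0_norm a0) ler_pdivrMr //.
have : 0 <= K * e by rewrite mulr_ge0 // (le_trans q1).
nra.
Qed.

End GegenbauerCoefficients.

Lemma rho_asymptotics (R : realType) (n : nat) :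
  exists C C' : R, [/\ 0 < C, 0 < C' &
    forall d l : nat, (2 <= d)%N -> C' * d%:R <= l%:R ->
      (rho R n d l <= (C * (d%:R / l%:R) ^+ 2)%:E)%E].
Proof.
pose K : R := 3 ^+ (2 * n) * ((2 * n).+1 * (2 * n).+1)%N%:R.
have K1 : 1 <= K.
  by rewrite mulr_ege1 ?exprn_ege1 ?ler1n.
(* The second constant gives d/l <= 1/(2K), so that K (d/l)^2 <= 1/2. The factor n + 1 keeps the
   first one positive for n = 0 too. *)
exists (n.+1%:R * (2 * K)), (2 * K); split.
- by rewrite mulr_gt0 // mulr_gt0 // (lt_le_trans ltr01).
- by rewrite mulr_gt0 // (lt_le_trans ltr01).
move=> d l hd dl.
have hD : 2 <= d%:R :> R by rewrite ler_nat.
have HJ := gegenbauer_int_functional R hd.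
have c0 := area_ratio_gt0 R d; set c := _ / _ in c0.
have l0 : 0 < l%:R :> R.
  by apply: lt_le_trans dl; rewrite mulr_gt0 //; lra.
pose f := fejer (d%:R : R) l.
have N0 := fejer_norm_gt0 HJ hD l.
pose s := Num.sqrt (c * gegenbauer_int d (f ^+ 2)).
have s2 : s ^+ 2 = c * gegenbauer_int d (f ^+ 2).
  by rewrite sqr_sqrtr // mulr_ge0 ?ltW.
have s20 : 0 < s ^+ 2 by rewrite s2 mulr_gt0.
pose q := s^-1 *: f.
have Jq p : c * gegenbauer_int d (p * q ^+ 2) =
    gegenbauer_int d (p * f ^+ 2) / gegenbauer_int d (f ^+ 2).
  rewrite /q exprZn -scalerAr (gegfZ HJ) exprVn s2.
  by field; rewrite !lt0r_neq0.
apply: le_trans (@rho_le R d hd n l ((d%:R / l%:R) ^+ 2) q _ _ _ _) _.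
- by rewrite (leq_trans (size_scale_leq _ _)) // size_fejer.
- rewrite gegenbauer_coefE // gegP0 mulr1 -[q ^+ 2]mul1r Jq mul1r divff //.
  exact: lt0r_neq0.
- rewrite Jq ler_pdivrMr // exprMn exprVn mulrAC ler_pdivlMr ?exprn_gt0 //.
  by rewrite mulrC fejer_ratio.
- rewrite -/K.
  have K20 : 0 < 2 * K by lra.
  have : d%:R / l%:R <= (2 * K)^-1.
    by rewrite ler_pdivrMr // mulrC ler_pdivlMr // mulrC.
  set x := _ / _ => hx.
  have x0 : 0 <= x by rewrite divr_ge0 ?ler0n.
  have K0 : 0 < K by lra.
  have : 2 * K * x <= 1 by rewrite mulrC -ler_pdivlMr ?div1r // mulr_gt0.
  move=> h; rewrite expr2; nra.
- rewrite lee_fin -/K ler_wpM2r ?sqr_ge0 // ler_wpM2r ?ler_nat //.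
  by rewrite mulr_ge0 //; lra.
Qed.

(** * Multivariate polynomials and harmonics *)

Section MPolyBasics.
Variables (R : realType) (d : nat).
Implicit Types (p q : mpoly d R) (x y : 'rV[R]_d) (i j : 'I_d).

Local Notation homog m := (@ishomog1 d R m mdeg).
Local Notation "''X_' i" := (@mpolyX d R (mnm1 i)) (at level 8, i at level 2, format "''X_' i").

Lemma mpoly_ring_ind (P : mpoly d R -> Prop) :
  (forall c, P (mpolyC d c)) -> (forall i, P 'X_i) ->
  (forall p q, P p -> P q -> P (p + q)) ->
  (forall p q, P p -> P q -> P (p * q)) -> forall p, P p.
Proof.
move=> PC PX PD PM; elim/mpolyind => [|c m p _ _ Pp].
  by rewrite -mpolyC0.
apply: (PD) => //; rewrite -mul_mpolyC; apply: (PM) => //.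
rewrite mpolyXE_id; apply: (big_ind P) => [|p1 p2|i _]; first by rewrite -mpolyC1.
  exact: PM.
by elim: (m i) => [|k IH]; [rewrite expr0 -mpolyC1|rewrite exprS; exact: PM].
Qed.

Lemma mpoly_at_sum x (I : Type) (r : seq I) (P : pred I) (F : I -> mpoly d R) :
  mpoly_at x (\sum_(k <- r | P k) F k) = \sum_(k <- r | P k) mpoly_at x (F k).
Proof. exact: (rmorph_sum (meval (fun i => x ord0 i))). Qed.

Lemma mpoly_atD x p q : mpoly_at x (p + q) = mpoly_at x p + mpoly_at x q.
Proof. exact: mevalD. Qed.
Lemma mpoly_atB x p q : mpoly_at x (p - q) = mpoly_at x p - mpoly_at x q.
Proof. exact: mevalB. Qed.
Lemma mpoly_atM x p q : mpoly_at x (p * q) = mpoly_at x p * mpoly_at x q.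
Proof. exact: mevalM. Qed.
Lemma mpoly_atZ x c p : mpoly_at x (c *: p) = c * mpoly_at x p.
Proof. exact: mevalZ. Qed.
Lemma mpoly_at_exp x p k : mpoly_at x (p ^+ k) = mpoly_at x p ^+ k.
Proof. exact: (rmorphXn (meval (fun i => x ord0 i))). Qed.
Lemma mpoly_atC x c : mpoly_at x (mpolyC d c) = c.
Proof. exact: mevalC. Qed.
Lemma mpoly_at_X x i : mpoly_at x 'X_i = x ord0 i.
Proof. exact: mevalXU. Qed.
Lemma mpoly_at_0 x : mpoly_at x 0 = 0.
Proof. exact: meval0. Qed.

Lemma mderiv_sum i (I : Type) (r : seq I) (P : pred I) (F : I -> mpoly d R) :
  mderiv i (\sum_(k <- r | P k) F k) = \sum_(k <- r | P k) mderiv i (F k).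
Proof. exact: raddf_sum. Qed.

Lemma mderivXU i j : mderiv i 'X_j = (i == j)%:R.
Proof.
apply/mpolyP => m; rewrite mcoeff_mderiv !mcoeffX; case: (i =P j) => [<-|ij].
  rewrite mcoeff1 -{1}[mnm1 i]add0m.
  rewrite eqm_add2r eq_sym; case: eqP => [->|_]; last by rewrite mul0rn.
  by rewrite mnm0E.
rewrite mcoeff0; case: eqP => [E|_]; last by rewrite mul0rn.
have := congr1 (fun m' : multinom d => m' i) E; rewrite mnmDE !mnm1E eqxx eq_sym.
by move/eqP: ij => /negPf->; rewrite addn1.
Qed.

(** The restriction of p to the line through x in direction i; its low coefficients at 0 are the
    partial derivatives of p at x. *)
Definition mline x i p : {poly R} :=
  mmap polyC (fun j => (x ord0 j)%:P + (i == j)%:R *: 'X) p.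

Lemma mlineD x i p q : mline x i (p + q) = mline x i p + mline x i q.
Proof. exact: mmapD. Qed.

Lemma mlineM x i p q : mline x i (p * q) = mline x i p * mline x i q.
Proof. exact: rmorphM. Qed.

Lemma mline_horner x i p t :
  (mline x i p).[t] = mpoly_at (x + t *: delta_mx ord0 i) p.
Proof.
elim/mpoly_ring_ind: p => [c|j|p q Hp Hq|p q Hp Hq].
- by rewrite /mline mmapC hornerC mpoly_atC.
- rewrite /mline mmapX mmap1U mpoly_at_X !mxE eqxx /= hornerD hornerC hornerZ.
  by rewrite hornerX mulrC eq_sym.
- by rewrite mlineD hornerD mpoly_atD -Hp -Hq.
- by rewrite mlineM hornerM mpoly_atM -Hp -Hq.
Qed.

Lemma deriv_mline x i p : (mline x i p)^`() = mline x i (mderiv i p).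
Proof.
elim/mpoly_ring_ind: p => [c|j|p q Hp Hq|p q Hp Hq].
- by rewrite mderivC /mline mmapC derivC mmap0.
- rewrite mderivXU /mline mmapX mmap1U derivD derivC derivZ derivX add0r.
  by rewrite rmorph_nat scaler_nat.
- by rewrite mderivD !mlineD derivD Hp Hq.
- by rewrite mderivM mlineD !mlineM derivM Hp Hq.
Qed.

Lemma mline_coef0 x i p : (mline x i p)`_0 = mpoly_at x p.
Proof. by rewrite -horner_coef0 mline_horner scale0r addr0. Qed.

Lemma mline_coef1 x i p : (mline x i p)`_1 = mpoly_at x (mderiv i p).
Proof. by rewrite -(mline_coef0 x i) -deriv_mline coef_deriv. Qed.

Lemma mline_coef2 x i p :
  (mline x i p)`_2 *+ 2 = mpoly_at x (mderiv i (mderiv i p)).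
Proof. by rewrite -mline_coef1 -deriv_mline coef_deriv. Qed.

Lemma poly_all_root (p : {poly R}) : (forall t, p.[t] = 0) -> p = 0.
Proof.
move=> p0; apply/eqP/negPn/negP => pn0.
pose s := [seq (k%:R : R) | k <- iota 0 (size p)].
have := @max_poly_roots _ p s pn0; rewrite size_map size_iota ltnn.
have -> : all (root p) s by apply/allP => t _; apply/rootP.
have -> : uniq s.
  by rewrite map_inj_uniq ?iota_uniq // => a b /eqP; rewrite eqr_nat => /eqP.
by move=> /(_ isT isT).
Qed.

Lemma mpoly_at_origin p : mpoly_at 0 p = mcoeff (mnm0 (n:=d)) p.
Proof.
elim/mpolyind: p => [|c m p _ _ IH]; first by rewrite mpoly_at_0 mcoeff0.
rewrite mpoly_atD mpoly_atZ IH mcoeffD mcoeffZ mcoeffX; congr (_ * _ + _).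
rewrite /mpoly_at mevalX; case: eqP => [->|m0].
  by rewrite big1 // => i _; rewrite mnm0E expr0.
have [i mi] : exists i, m i != 0%N.
  apply/existsP; rewrite -negb_forall; apply/negP => /forallP h; case: m0.
  by apply/mnmP => i; rewrite mnm0E; apply/eqP.
by rewrite (bigD1 i) //= mxE expr0n (negPf mi) mul0r.
Qed.

(** Partial derivatives of p vanish everywhere as well, by restriction to lines, and lower a
    monomial until its coefficient is a value at the origin. *)
Lemma mpoly_at_eq0 p : (forall x, mpoly_at x p = 0) -> p = 0.
Proof.
move=> p0; apply/mpolyP => m; rewrite mcoeff0.
move: {2}(mdeg m) (erefl (mdeg m)) => n; elim: n m p p0 => [|n IH] m p p0 mn.
  by move/eqP: mn; rewrite mdeg_eq0 => /eqP->; rewrite -mpoly_at_origin.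
have [i mi] : exists i, m i != 0%N.
  apply/existsP; rewrite -negb_forall; apply/negP => /forallP h.
  by move: mn; rewrite mdegE big1 // => i _; apply/eqP.
have mE : m = mnm_add (mnm_sub m (mnm1 i)) (mnm1 i) by rewrite submK // lep1mP.
have := IH (mnm_sub m (mnm1 i)) (mderiv i p).
rewrite mcoeff_mderiv -mE => H; apply/eqP.
suff /eqP : mcoeff m p *+ ((mnm_sub m (mnm1 i)) i).+1 = 0 by rewrite mulrn_eq0.
apply: H => [x|].
  rewrite -mline_coef1 (_ : mline x i p = 0) ?coef0 //.
  by apply: poly_all_root => t; rewrite mline_horner p0.
by apply: succn_inj; rewrite -mn {2}mE mdegD mdeg1 addn1.
Qed.

Lemma mpoly_at_inj p q : (forall x, mpoly_at x p = mpoly_at x q) -> p = q.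
Proof.
move=> pq; apply/eqP; rewrite -subr_eq0; apply/eqP/mpoly_at_eq0 => x.
by rewrite mpoly_atB pq subrr.
Qed.

Lemma homog_scale m p x t : p \is homog m ->
  mpoly_at (t *: x) p = t ^+ m * mpoly_at x p.
Proof.
move=> /dhomogP hp; rewrite /mpoly_at !mevalE mulr_sumr; apply: eq_big_seq => k km.
rewrite mulrCA; congr (_ * _); have := hp _ km; rewrite /= => <-; rewrite mdegE expr_sum -big_split /=.
by apply: eq_bigr => i _; rewrite mxE exprMn.
Qed.

Lemma mderiv_homog m p i : p \is homog m -> mderiv i p \is homog m.-1.
Proof.
move=> hp; apply/dhomogP => k; rewrite mcoeff_msupp mcoeff_mderiv mulrn_eq0 /=.
rewrite -mcoeff_msupp => /(dhomog_mf hp) /= <-.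
by rewrite mdegD mdeg1 addn1.
Qed.

Lemma mderiv_homog0 p i : p \is homog 0 -> mderiv i p = 0.
Proof.
move=> hp; apply/mpolyP => k; rewrite mcoeff_mderiv mcoeff0.
by rewrite (dhomog_nemf_coeff hp) ?mul0rn //= mdegD mdeg1 addn1.
Qed.

Lemma laplacian_homog m p : p \is homog m -> laplacian p \is homog m.-2.
Proof. by move=> hp; rewrite /laplacian rpred_sum // => i _; do 2!apply: mderiv_homog. Qed.

Lemma euler m p : p \is homog m -> \sum_i 'X_i * mderiv i p = m%:R *: p.
Proof.
move=> /dhomogP hp.
rewrite [in LHS](mpolyE p); under eq_bigr do rewrite mderiv_sum mulr_sumr.
rewrite exchange_big /= [in RHS](mpolyE p) scaler_sumr; apply: eq_big_seq => k km.
have := hp _ km; rewrite /= => <-; rewrite mdegE natr_sum scaler_suml; apply: eq_bigr => i _.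
rewrite mderivZ mderivX; have [->|k0] := eqVneq (k i) 0%N.
  by rewrite !scale0r scaler0 mulr0.
by rewrite -!scalerAr -mpolyXD addmC submK ?lep1mP // scalerA mulrC -scalerA.
Qed.

End MPolyBasics.

(** * The Laplacian and the decomposition into harmonics *)

Section Laplacian.
Variables (R : realType) (d : nat).
Implicit Types (p q h : mpoly d R) (x y : 'rV[R]_d) (i : 'I_d) (j m : nat).

Local Notation homog m := (@ishomog1 d R m mdeg).
Local Notation "''X_' i" := (@mpolyX d R (mnm1 i)) (at level 8, i at level 2, format "''X_' i").

Definition sqn : mpoly d R := \sum_i 'X_i ^+ 2.
Definition lin x : mpoly d R := \sum_i x ord0 i *: 'X_i.

Lemma laplacianD p q : laplacian (p + q) = laplacian p + laplacian q.
Proof. by rewrite /laplacian -big_split; apply: eq_bigr => i _; rewrite !mderivD. Qed.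

Lemma laplacianZ c p : laplacian (c *: p) = c *: laplacian p.
Proof. by rewrite /laplacian scaler_sumr; apply: eq_bigr => i _; rewrite !mderivZ. Qed.

Lemma laplacian0 : laplacian (0 : mpoly d R) = 0.
Proof. by rewrite /laplacian big1 // => i _; rewrite !mderiv0. Qed.

Lemma laplacianB p q : laplacian (p - q) = laplacian p - laplacian q.
Proof. by rewrite -scaleN1r laplacianD laplacianZ scaleN1r. Qed.

Lemma laplacian_sum (I : Type) (r : seq I) (P : pred I) (F : I -> mpoly d R) :
  laplacian (\sum_(k <- r | P k) F k) = \sum_(k <- r | P k) laplacian (F k).
Proof. exact: (big_morph _ laplacianD laplacian0). Qed.

Lemma laplacianM p q : laplacian (p * q) =
  p * laplacian q + laplacian p * q + 2 *: \sum_i mderiv i p * mderiv i q.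
Proof.
rewrite /laplacian mulr_sumr mulr_suml scaler_sumr -!big_split /=.
apply: eq_bigr => i _; rewrite mderivM mderivD !mderivM scaler_nat; ring.
Qed.

Lemma laplacian_mderiv i p : laplacian (mderiv i p) = mderiv i (laplacian p).
Proof.
rewrite /laplacian mderiv_sum; apply: eq_bigr => j _.
by rewrite (mderiv_comm i j p) (mderiv_comm i j (mderiv j p)).
Qed.

Lemma laplacian_lowdeg m p : (m < 2)%N -> p \is homog m -> laplacian p = 0.
Proof.
move=> m2 hp; rewrite /laplacian big1 // => i _; apply: mderiv_homog0.
by have := mderiv_homog i hp; case: m m2 {hp} => [|[|]].
Qed.

Lemma mderiv_sqn i : mderiv i sqn = 2 *: 'X_i.
Proof.
rewrite /sqn mderiv_sum (bigD1 i) //= big1 ?addr0 => [|j ji].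
  by rewrite expr2 mderivM mderivXU eqxx mul1r mulr1 scaler_nat mulr2n.
by rewrite expr2 mderivM mderivXU eq_sym (negPf ji) mul0r mulr0 addr0.
Qed.

Lemma mpoly_at_sqn x : mpoly_at x sqn = sqnorm x.
Proof.
by rewrite mpoly_at_sum; apply: eq_bigr => i _; rewrite mpoly_at_exp mpoly_at_X.
Qed.

Lemma laplacian_sqn : laplacian sqn = mpolyC d (2 * d%:R).
Proof.
rewrite /laplacian; under eq_bigr do rewrite mderiv_sqn mderivZ mderivXU eqxx.
by rewrite sumr_const card_ord -mul_mpolyC mulr1 -mpolyCMn mulr_natr.
Qed.

Lemma sqn_homog : sqn \is homog 2.
Proof.
apply: rpred_sum => i _; rewrite (_ : 2%N = (1 * 2)%N) //.
by apply: dhomogMn; rewrite dhomogX /= mdeg1.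
Qed.

Lemma laplacian_sqnM m p : p \is homog m ->
  laplacian (sqn * p) = sqn * laplacian p + (2 * d%:R + 4 * m%:R) *: p.
Proof.
move=> hp; rewrite laplacianM laplacian_sqn mul_mpolyC -addrA; congr (_ + _).
under eq_bigr do rewrite mderiv_sqn -scalerAl.
rewrite -scaler_sumr (euler hp) !scalerA -scalerDl; congr (_ *: _); ring.
Qed.

(* The eigenvalue of p |-> sqn * laplacian p on [sqn ^+ j * h], for [h]
   harmonic of degree [m]. *)
Definition lapeig j m : R := 2 * j%:R * (2 * j%:R + 2 * m%:R + d%:R - 2).

Lemma sqnX_homog j m p : p \is homog m -> sqn ^+ j * p \is homog (2 * j + m).
Proof. by move=> hp; apply: dhomogM hp; apply: dhomogMn; exact: sqn_homog. Qed.

Lemma laplacian_sqnX j m h : h \is homog m -> laplacian h = 0 ->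
  laplacian (sqn ^+ j * h) = lapeig j m *: (sqn ^+ j.-1 * h).
Proof.
move=> hh h0; elim: j => [|j IH].
  by rewrite expr0 mul1r h0 /lapeig !mulr0 !mul0r scale0r.
rewrite exprS -mulrA (laplacian_sqnM (sqnX_homog j hh)) IH /=.
have -> : sqn * (lapeig j m *: (sqn ^+ j.-1 * h)) = lapeig j m *: (sqn ^+ j * h).
  case: j {IH} => [|j]; first by rewrite /lapeig !(mulr0, mul0r) !scale0r mulr0.
  by rewrite -scalerAr mulrA -exprS.
rewrite -scalerDl; congr (_ *: _).
by rewrite /lapeig natrD natrM -(natr1 j); ring.
Qed.

Lemma lapeig_gt0 j m : (1 <= d)%N -> 0 < lapeig j.+1 m.
Proof.
move=> d1; have : 1 <= d%:R :> R by rewrite ler1n.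
rewrite /lapeig -(natr1 j); have := ler0n R j; have := ler0n R m => m0 j0 d0.
by rewrite mulr_gt0 //; lra.
Qed.

(** Decompose the Laplacian of p by induction; since [laplacian] acts on each [sqn ^+ j.+1 * g j] by
    a nonzero scalar, a preimage [G] is explicit, and p - G is the harmonic part. *)
Lemma harmonic_decomposition m p : (1 <= d)%N -> p \is homog m ->
  exists h : nat -> mpoly d R,
    (forall j, h j \is homog (m - 2 * j) /\ laplacian (h j) = 0) /\
    p = \sum_(j < m./2.+1) sqn ^+ j * h j.
Proof.
move=> d1; elim/ltn_ind: m p => m IH p hp; have [m2|m2] := ltnP m 2.
  exists (fun j => if j is 0 then p else 0); split=> [[|j]|].
  - by rewrite muln0 subn0 (laplacian_lowdeg m2 hp).
  - by rewrite dhomog0 laplacian0.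
  rewrite (_ : m./2 = 0%N) ?big_ord1 ?expr0 ?mul1r //.
  by case: m m2 {IH hp} => [|[|]].
have mE : m = m.-2.+2 by case: m m2 {IH hp} => [|[|]].
have [||g [hg pE]] := IH m.-2 _ (laplacian p).
- by rewrite [ltnRHS]mE.
- exact: laplacian_homog.
pose k j := lapeig j.+1 (m.-2 - 2 * j).
pose G := \sum_(j < m.-2./2.+1) (k j)^-1 *: (sqn ^+ j.+1 * g j).
have hG : G \is homog m.
  apply: rpred_sum => j _; apply: dhomogZ.
  have jm : (2 * j <= m.-2)%N.
    by rewrite mul2n -geq_half_double -ltnS.
  have := sqnX_homog j.+1 (proj1 (hg j)).
  by rewrite mulnS -addnA subnKC // add2n -mE.
exists (fun j => if j is i.+1 then (k i)^-1 *: g i else p - G); split=> [[|j]|].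
- rewrite muln0 subn0 rpredB //; split=> //.
  rewrite laplacianB {1}pE /G laplacian_sum -sumrB big1 // => j _.
  have [h1 h2] := hg j; rewrite laplacianZ (laplacian_sqnX _ h1 h2) scalerA mulVf.
    by rewrite scale1r subrr.
  by rewrite lt0r_neq0 // lapeig_gt0.
- have [h1 h2] := hg j; rewrite laplacianZ h2 scaler0; split=> //.
  by rewrite mulnS mE subSS subSS; apply: dhomogZ.
rewrite [in RHS]mE /= big_ord_recl expr0 mul1r /= -[LHS](subrK G); congr (_ + _).
by apply: eq_bigr => j _; rewrite -scalerAr.
Qed.

End Laplacian.

Lemma horner_bound (R : realDomainType) (p : {poly R}) (t : R) : `|t| <= 1 ->
  `|p.[t]| <= \sum_(i < size p) `|p`_i|.
Proof.
move=> t1; rewrite horner_coef; apply: le_trans (ler_norm_sum _ _ _) _.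
by apply: ler_sum => i _; rewrite normrM ler_piMr // normrX exprn_ile1.
Qed.

(** Adding the inequalities at t and -t cancels the linear term; for small t the cubic remainder
    cannot outweigh a negative quadratic one. *)
Lemma coef2_local_min (R : realFieldType) (r : {poly R}) (e : R) : 0 < e ->
  (forall t, `|t| <= e -> r.[0] <= r.[t]) -> 0 <= r`_2.
Proof.
move=> e0 hr; rewrite leNgt; apply/negP => r2.
pose w := drop_poly 3 r; pose M := \sum_(i < size w) `|w`_i|.
have M0 : 0 <= M by apply: sumr_ge0.
have rE t : r.[t] = r`_0 + r`_1 * t + r`_2 * t ^+ 2 + w.[t] * t ^+ 3.
  rewrite -[in LHS](poly_take_drop 3 r) hornerD hornerM hornerXn.
  by rewrite horner_poly !big_ord_recr big_ord0 /= add0r expr0 mulr1 expr1.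
pose t := Num.min e (Num.min 1 (- r`_2 / (M + 1) / 2)).
have t0 : 0 < t.
  by rewrite !lt_min e0 ltr01 /= divr_gt0 // divr_gt0 ?oppr_gt0 //; lra.
have te : t <= e by rewrite ge_min lexx.
have t1 : t <= 1 by rewrite !ge_min lexx orbT.
have t2 : t <= - r`_2 / (M + 1) / 2 by rewrite !ge_min lexx !orbT.
have h1 := hr t; have h2 := hr (- t).
rewrite normrN gtr0_norm // in h2; rewrite gtr0_norm // in h1.
move: (h1 te) (h2 te); rewrite !rE => {}h1 {}h2.
have w1 : `|w.[t]| <= M by apply: horner_bound; rewrite gtr0_norm.
have w2 : `|w.[- t]| <= M by apply: horner_bound; rewrite normrN gtr0_norm.
move: w1 w2; rewrite !ler_norml => /andP[a1 a2] /andP[b1 b2].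
have tM : t * (2 * (M + 1)) <= - r`_2.
  by move: t2; rewrite -!ler_pdivlMr //; [move=> ?; rewrite invfM mulrA mulrAC|lra].
have : 0 <= t ^+ 2 * (2 * r`_2 + t * (w.[t] - w.[- t])) by lra.
rewrite pmulr_rge0 ?exprn_gt0 // => h.
have : t * (w.[t] - w.[- t]) <= t * (2 * M) by rewrite ler_wpM2l ?(ltW t0) //; lra.
nra.
Qed.

Section MaximumPrinciple.
Variables (R : realType) (d : nat).
Implicit Types (p q h : mpoly d R) (x y : 'rV[R]_d) (i : 'I_d).

Lemma continuous_mpoly_at p : continuous (fun x => mpoly_at x p).
Proof.
elim/mpoly_ring_ind: p => [c|i|p q Hp Hq|p q Hp Hq] x.
- rewrite (_ : (fun x => _) = cst c); first exact: cst_continuous.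
  by apply/funext => y; rewrite mpoly_atC.
- rewrite (_ : (fun x => _) = (fun x : 'rV_d => x ord0 i)); first exact: coord_continuous.
  by apply/funext => y; rewrite mpoly_at_X.
- rewrite (_ : (fun x => _) = (fun x => mpoly_at x p + mpoly_at x q)).
    by apply: continuousD; [exact: Hp|exact: Hq].
  by apply/funext => y; rewrite mpoly_atD.
- rewrite (_ : (fun x => _) = (fun x => mpoly_at x p * mpoly_at x q)).
    by apply: continuousM; [exact: Hp|exact: Hq].
  by apply/funext => y; rewrite mpoly_atM.
Qed.

Lemma coord_sqnorm_le x i : x ord0 i ^+ 2 <= sqnorm x.
Proof.
rewrite /sqnorm (bigD1 i) //= lerDl sumr_ge0 // => j _; exact: sqr_ge0.
Qed.

Lemma sqnorm_ge0 x : 0 <= sqnorm x.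
Proof. by apply: sumr_ge0 => i _; exact: sqr_ge0. Qed.

Lemma compact_ball : compact [set x : 'rV[R]_d | sqnorm x <= 1].
Proof.
have c1 := @rV_compact R d (fun=> [set` `[-1, 1]]) (fun=> @segment_compact R (-1) 1).
apply: (subclosed_compact _ c1).
  rewrite (_ : [set x | _] = (fun x => mpoly_at x (@sqn R d)) @^-1` [set t | t <= 1]).
    apply: closed_comp => [x _|]; [exact: continuous_mpoly_at|exact: closed_le].
  by apply/seteqP; split=> x /=; rewrite mpoly_at_sqn.
move=> x /= x1 i; rewrite in_itv /= -ler_norml -(@expr_le1 _ 2) // real_normK ?num_real //.
exact: le_trans (coord_sqnorm_le x i) x1.
Qed.

Lemma sqnorm_line x i t : sqnorm (x + t *: delta_mx ord0 i) =
  sqnorm x + 2 * t * x ord0 i + t ^+ 2.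
Proof.
rewrite /sqnorm (bigD1 i) //= [in RHS](bigD1 i) //= !mxE !eqxx mulr1.
rewrite (eq_bigr (fun j => x ord0 j ^+ 2)); first ring.
by move=> j ji; rewrite !mxE (negPf ji) andbF mulr0 addr0.
Qed.

(* Maximum principle: at a minimum of u - e |x|^2 inside the ball some second
   derivative would be negative. *)
Lemma harmonic_ge0 u : (1 <= d)%N -> laplacian u = 0 ->
  (forall x, sphere d x -> 0 <= mpoly_at x u) -> 0 <= mpoly_at 0 u.
Proof.
move=> d1 Lu pos; rewrite leNgt; apply/negP => u0.
(* On the sphere v >= -e, while v(0) = -2e, so the minimum of v is interior. *)
pose e := - mpoly_at 0 u / 2; have e0 : 0 < e by rewrite /e; lra.
pose v := u - e *: @sqn R d.
have vE x : mpoly_at x v = mpoly_at x u - e * sqnorm x.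
  by rewrite mpoly_atB mpoly_atZ mpoly_at_sqn.
have n0 : sqnorm (0 : 'rV[R]_d) = 0.
  by rewrite /sqnorm big1 // => i _; rewrite mxE expr0n.
have [||c] := EVT_min_rV (f := fun x => mpoly_at x v) _ compact_ball.
- by exists 0; rewrite /= n0.
- exact/continuous_subspaceT/continuous_mpoly_at.
rewrite inE /= => c1 cmin.
have c2 : sqnorm c < 1.
  rewrite lt_neqAle c1 andbT; apply/eqP => cS.
  have := cmin 0; rewrite !vE n0 mulr0 subr0 cS mulr1 inE /= n0 => /(_ ler01).
  have := pos c cS; rewrite /e; lra.
have D2 i : 0 <= mpoly_at c (mderiv i (mderiv i v)).
  rewrite -mline_coef2 pmulrn_lge0 //.
  (* A step t with |t| <= 1 changes the squared norm by at most 3|t|, which keeps the point in the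
     ball. *)
  apply: (@coef2_local_min _ _ ((1 - sqnorm c) / 3)); first lra.
  move=> t; rewrite ler_norml => /andP[t1 t2]; rewrite !mline_horner scale0r addr0.
  apply: cmin; rewrite inE /= sqnorm_line.
  have ci := coord_sqnorm_le c i; have s0 := sqnorm_ge0 c.
  have ci1 : `|c ord0 i| <= 1.
    by rewrite -(@expr_le1 _ 2) // real_normK ?num_real // (le_trans ci).
  move: ci1; rewrite ler_norml => /andP[ci1 ci2].
  nra.
have : 0 <= mpoly_at c (laplacian v).
  by rewrite /laplacian mpoly_at_sum sumr_ge0.
rewrite laplacianB Lu laplacianZ laplacian_sqn sub0r -scaleNr mpoly_atZ mpoly_atC.
apply/negP; rewrite -ltNge mulNr oppr_lt0 mulr_gt0 // mulr_gt0 //.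
by rewrite ltr0n.
Qed.

End MaximumPrinciple.

(** * The average over the sphere *)

Section SphereAverage.
Variables (R : realType) (d : nat).
Hypothesis hd : (2 <= d)%N.
Implicit Types (p q h : mpoly d R) (x y : 'rV[R]_d) (i : 'I_d) (j m n : nat).

Local Notation homog m := (@ishomog1 d R m mdeg).
Local Notation lap j := (iter j (@laplacian R d)).

Let hD : 2 <= d%:R :> R. Proof. by rewrite ler_nat. Qed.
Let d1 : (1 <= d)%N. Proof. exact: ltnW. Qed.

(** The denominators are the eigenvalues [lapeig] of degree m = 0, so that every power of |x|^2 has
    average 1. *)
Fixpoint avg_coef j : R :=
  if j is k.+1 then avg_coef k / ((2 * k%:R + 2) * (2 * k%:R + d%:R)) else 1.

(* Pizzetti's formula: this is the average of p over the unit sphere. *)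
Definition sphere_avg p : R :=
  \sum_(j < msize p) avg_coef j * mpoly_at 0 (lap j p).

Lemma iter_laplacianD j p q : lap j (p + q) = lap j p + lap j q.
Proof. by elim: j => //= j ->; rewrite laplacianD. Qed.

Lemma iter_laplacianZ j c p : lap j (c *: p) = c *: lap j p.
Proof. by elim: j => //= j ->; rewrite laplacianZ. Qed.

Lemma iter_laplacian0 j : lap j 0 = 0.
Proof. by elim: j => //= j ->; rewrite laplacian0. Qed.

Lemma iter_laplacian_high n j p : (n <= j)%N ->
  (forall m : multinom d, (n <= mdeg m)%N -> mcoeff m p = 0) -> mpoly_at 0 (lap j p) = 0.
Proof.
move=> nj hp; rewrite mpoly_at_origin.
have key k : forall m : multinom d, (n - k <= mdeg m)%N -> mcoeff m (lap k p) = 0.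
  elim: k => [|k IH] m mk; first by rewrite hp // -(subn0 n).
  rewrite /= /laplacian raddf_sum big1 // => i _ /=.
  rewrite !mcoeff_mderiv IH ?mul0rn // !mdegD !mdeg1.
  by move: mk; rewrite !leq_subLR => mk; rewrite (leq_trans mk) // !addn1 !addnS !addSn leqW.
by apply: key; rewrite (_ : n - j = 0)%N //; apply/eqP.
Qed.

Lemma sphere_avg_wide n p : (msize p <= n)%N ->
  sphere_avg p = \sum_(j < n) avg_coef j * mpoly_at 0 (lap j p).
Proof.
move=> pn; rewrite -(subnKC pn) big_split_ord /= [X in _ + X]big1 ?addr0 // => j _.
rewrite (@iter_laplacian_high (msize p)) ?mulr0 ?leq_addr // => m pm.
by apply: memN_msupp_eq0; exact: msize_mdeg_ge.
Qed.

Lemma sphere_avg_linear a p q :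
  sphere_avg (a *: p + q) = a * sphere_avg p + sphere_avg q.
Proof.
pose n := maxn (msize (a *: p + q)) (maxn (msize p) (msize q)).
rewrite !(@sphere_avg_wide n) ?leq_max ?leqnn ?orbT // mulr_sumr -big_split /=.
apply: eq_bigr => j _.
by rewrite iter_laplacianD iter_laplacianZ mpoly_atD mpoly_atZ; ring.
Qed.

Lemma sphere_avg0 : sphere_avg 0 = 0.
Proof. by rewrite /sphere_avg mmeasure0 big_ord0. Qed.

Lemma sphere_avgZ a p : sphere_avg (a *: p) = a * sphere_avg p.
Proof. by rewrite -[a *: p]addr0 sphere_avg_linear sphere_avg0 addr0. Qed.

Lemma sphere_avgD p q : sphere_avg (p + q) = sphere_avg p + sphere_avg q.
Proof. by rewrite -[p]scale1r sphere_avg_linear mul1r scale1r. Qed.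

Lemma sphere_avg_sum (I : Type) (r : seq I) (P : pred I) (F : I -> mpoly d R) :
  sphere_avg (\sum_(k <- r | P k) F k) = \sum_(k <- r | P k) sphere_avg (F k).
Proof. exact: (big_morph _ sphere_avgD sphere_avg0). Qed.

Lemma iter_laplacian_homog j m p : p \is homog m -> m != (2 * j)%N ->
  mpoly_at 0 (lap j p) = 0.
Proof.
elim: j m p => [|j IH] m p hp mj.
  by rewrite mpoly_at_origin /= (dhomog_nemf_coeff hp) //= mdeg0 eq_sym.
rewrite iterSr; have [m2|m2] := ltnP m 2.
  by rewrite (laplacian_lowdeg m2 hp) iter_laplacian0 mpoly_at_0.
apply: IH (laplacian_homog hp) _; apply: contra mj => /eqP e.
by rewrite mulnS -e; case: m m2 {hp e} => [|[|]].
Qed.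

(* For p homogeneous of degree m, the difference m (m + d - 2) p - laplacian p
   is, on the sphere, minus the spherical Laplacian of p. *)
Lemma sphere_avg_laplacian m p : p \is homog m ->
  m%:R * (m%:R + d%:R - 2) * sphere_avg p = sphere_avg (laplacian p).
Proof.
move=> hp; pose n := maxn (msize p) (msize (laplacian p)).
rewrite (@sphere_avg_wide n.+1) ?(leqW (leq_maxl _ _)) //.
rewrite (@sphere_avg_wide n (laplacian p)) ?leq_maxr //.
rewrite big_ord_recl /= [LHS]mulrDr [X in _ + X]mulr_sumr; have -> : m%:R * (m%:R + d%:R - 2) * (1 * mpoly_at 0 p) = 0.
  have [->|m0] := eqVneq m 0%N; first by rewrite !mul0r.
  by rewrite (@iter_laplacian_homog 0 m p) ?muln0 // !mulr0.
rewrite add0r; apply: eq_bigr => j _; rewrite add0n -iterS iterSr.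
have [mE|mE] := eqVneq m (2 * j.+1)%N; last first.
  by rewrite -iterSr (iter_laplacian_homog hp mE) !mulr0.
rewrite mE natrM -(natr1 j); have j0 := ler0n R j.
by field; apply/andP; split; apply: lt0r_neq0; have := hD; lra.
Qed.

Lemma sphere_avgC c : sphere_avg (mpolyC d c) = c.
Proof.
rewrite (@sphere_avg_wide 1) ?big_ord1 /= ?mul1r ?mpoly_atC //.
by rewrite mmeasureC leq_b1.
Qed.

(** The algebraic average has to be shown blind to factors |x|^2. For m > 0 both sides vanish; for m
    = 0 the two eigenvalue factors in [sphere_avg_laplacian] agree. *)
Lemma sphere_avg_sqnX j m h : h \is homog m -> laplacian h = 0 ->
  sphere_avg (@sqn R d ^+ j * h) = mpoly_at 0 h.
Proof.
move=> hh h0.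
have hh0 : m != 0%N -> mpoly_at 0 h = 0.
  by move=> m0; rewrite (@iter_laplacian_homog 0 m h) ?muln0.
have D2 := hD; have m0 := ler0n R m.
elim: j => [|j IH].
  rewrite expr0 mul1r; have [mE|mN] := eqVneq m 0%N.
    have -> : h = mpolyC d (mcoeff (mnm0 (n:=d)) h).
      apply/mpolyP => k; rewrite mcoeffC; case: eqP => [->|k0]; first by rewrite mulr1.
      rewrite mulr0 (dhomog_nemf_coeff hh) //= mE mdeg_eq0; exact/eqP.
    by rewrite sphere_avgC mpoly_atC.
  have := sphere_avg_laplacian hh; rewrite h0 sphere_avg0 (hh0 mN) => /eqP.
  have m1 : 1 <= m%:R :> R by rewrite ler1n lt0n.
  rewrite mulf_eq0 gt_eqF ?mulr_gt0 //=; [by move/eqP|lra|lra].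
have := sphere_avg_laplacian (sqnX_homog j.+1 hh).
rewrite (laplacian_sqnX _ hh h0) sphere_avgZ IH => E.
have j0 := ler0n R j.
have M0 : 0 < (2 * j.+1 + m)%N%:R * ((2 * j.+1 + m)%N%:R + d%:R - 2) :> R.
  by rewrite natrD natrM -(natr1 j) mulr_gt0 //; lra.
apply: (mulfI (lt0r_neq0 M0)); rewrite E.
have [mE|/hh0->] := eqVneq m 0%N; last by rewrite !mulr0.
by rewrite /lapeig mE natrD natrM; ring.
Qed.

(** Replace |x|^2 by 1 in the harmonic decomposition of each monomial. *)
Lemma harmonic_extension p : exists u, [/\ laplacian u = 0,
  forall x, sphere d x -> mpoly_at x u = mpoly_at x p &
  mpoly_at 0 u = sphere_avg p].
Proof.
elim/mpolyind: p => [|c k p _ _ [u [u0 uS uE]]].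
  by exists 0; split; rewrite ?laplacian0 ?mpoly_at_0 ?sphere_avg0.
have hk : @mpolyX d R k \is homog (mdeg k) by rewrite dhomogX.
have [h [hh kE]] := harmonic_decomposition d1 hk.
exists (c *: \sum_(j < (mdeg k)./2.+1) h j + u); split.
- rewrite laplacianD laplacianZ u0 laplacian_sum big1 ?scaler0 ?addr0 // => j _.
  by case: (hh j).
- move=> x xS; rewrite !mpoly_atD !mpoly_atZ uS // kE !mpoly_at_sum.
  congr (_ * _ + _); apply: eq_bigr => j _.
  by rewrite mpoly_atM mpoly_at_exp mpoly_at_sqn xS expr1n mul1r.
- rewrite mpoly_atD mpoly_atZ uE sphere_avg_linear kE sphere_avg_sum mpoly_at_sum.
  congr (_ * _ + _); apply: eq_bigr => j _.
  by have [h1 h2] := hh j; rewrite (sphere_avg_sqnX _ h1 h2).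
Qed.

Lemma sphere_avg_ge0 p : (forall x, sphere d x -> 0 <= mpoly_at x p) ->
  0 <= sphere_avg p.
Proof.
have [u [u0 uS <-]] := harmonic_extension p => hp.
by apply: harmonic_ge0 => // x xS; rewrite uS // hp.
Qed.

End SphereAverage.

(** * The Funk-Hecke formula *)

Section FunkHecke.
Variables (R : realType) (d : nat) (J : {poly R} -> R).
Hypothesis hd : (2 <= d)%N.
Hypothesis HJ : gegenbauer_functional d%:R J.
Implicit Types (p q h : mpoly d R) (x y : 'rV[R]_d) (i : 'I_d) (j m n : nat).

Local Notation homog m := (@ishomog1 d R m mdeg).
Let hD : 2 <= d%:R :> R. Proof. by rewrite ler_nat. Qed.

Lemma mderiv_lin x i : mderiv i (lin x) = mpolyC d (x ord0 i).
Proof.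
rewrite /lin mderiv_sum (bigD1 i) //= big1 ?addr0 => [|j ji].
  by rewrite mderivZ mderivXU eqxx -mul_mpolyC mulr1.
by rewrite mderivZ mderivXU eq_sym (negPf ji) scaler0.
Qed.

Lemma lin_homog x : lin x \is homog 1.
Proof. by apply: rpred_sum => i _; apply: dhomogZ; rewrite dhomogX /= mdeg1. Qed.

Lemma mderiv_linX x i m :
  mderiv i (lin x ^+ m) = (m%:R * x ord0 i) *: lin x ^+ m.-1.
Proof.
elim: m => [|m IH]; first by rewrite expr0 -mpolyC1 mderivC mul0r scale0r.
rewrite exprS mderivM mderiv_lin IH mul_mpolyC /=.
have -> : lin x * ((m%:R * x ord0 i) *: lin x ^+ m.-1) = (m%:R * x ord0 i) *: lin x ^+ m.
  case: m {IH} => [|m]; first by rewrite mul0r !scale0r mulr0.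
  by rewrite -scalerAr -exprS.
by rewrite -scalerDl -(natr1 m); congr (_ *: _); ring.
Qed.

(** The cross term in the Laplacian of [lin x ^+ m * h]: again harmonic, of one degree less, and
    evaluated at x by Euler's identity. *)
Definition dirderiv x p := \sum_i x ord0 i *: mderiv i p.

Lemma laplacian_linX x m : laplacian (lin x ^+ m) =
  (m%:R * (m%:R - 1) * sqnorm x) *: lin x ^+ m.-2.
Proof.
rewrite /laplacian; under eq_bigr do rewrite mderiv_linX mderivZ mderiv_linX scalerA.
rewrite -scaler_suml /sqnorm mulr_sumr; congr (_ *: _); apply: eq_bigr => i _.
by case: m => [|m]; rewrite ?mul0r //= -(natr1 m); ring.
Qed.

Lemma laplacian_linXM x m h : laplacian h = 0 ->
  laplacian (lin x ^+ m * h) =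
  (m%:R * (m%:R - 1) * sqnorm x) *: (lin x ^+ m.-2 * h) +
  (2 * m%:R) *: (lin x ^+ m.-1 * dirderiv x h).
Proof.
move=> h0; rewrite laplacianM h0 mulr0 add0r laplacian_linX -scalerAl.
congr (_ + _); rewrite -[RHS]scalerA; congr (_ *: _).
rewrite /dirderiv mulr_sumr scaler_sumr.
by apply: eq_bigr => i _; rewrite mderiv_linX -scalerAl -scalerAr !scalerA.
Qed.

Lemma dirderiv_harmonic x h : laplacian h = 0 -> laplacian (dirderiv x h) = 0.
Proof.
move=> h0; rewrite /dirderiv laplacian_sum big1 // => i _.
by rewrite laplacianZ laplacian_mderiv h0 mderiv0 scaler0.
Qed.

Lemma dirderiv_homog x m h : h \is homog m -> dirderiv x h \is homog m.-1.
Proof.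
by move=> hh; apply: rpred_sum => i _; apply: dhomogZ; exact: mderiv_homog.
Qed.

Lemma mpoly_at_dirderiv x m h : h \is homog m ->
  mpoly_at x (dirderiv x h) = m%:R * mpoly_at x h.
Proof.
move=> hh; rewrite -mpoly_atZ -(euler hh) !mpoly_at_sum.
by apply: eq_bigr => i _; rewrite mpoly_atZ mpoly_atM mpoly_at_X.
Qed.

(* Both sides satisfy the recursion [gegm_rec] in the exponent m: on the left it
   is [sphere_avg_laplacian]. *)
Lemma funk_hecke_linX x m n h : sphere d x -> h \is homog n -> laplacian h = 0 ->
  J 1 * sphere_avg (lin x ^+ m * h) = gegm d%:R J m n * mpoly_at x h.
Proof.
move=> xS; elim/ltn_ind: m n h => m IH n h hh h0.
have hm : lin x ^+ m * h \is homog (m + n).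
  by apply: dhomogM hh; rewrite -[m in homog m]mul1n; apply: dhomogMn; exact: lin_homog.
have [mn0|mn] := eqVneq (m + n)%N 0%N.
  move/eqP: mn0; rewrite addn_eq0 => /andP[/eqP mE /eqP nE].
  have -> : h = mpolyC d (mcoeff (mnm0 (n:=d)) h).
    apply/mpolyP => k; rewrite mcoeffC; case: eqP => [->|k0]; first by rewrite mulr1.
    rewrite mulr0 (dhomog_nemf_coeff hh) //= nE mdeg_eq0; exact/eqP.
  by rewrite mE nE expr0 mul1r sphere_avgC mpoly_atC /gegm gegP0 !mulr1.
have := sphere_avg_laplacian hd hm; rewrite (laplacian_linXM _ _ h0) (_ : sqnorm x = 1) //.
rewrite mulr1 sphere_avgD !sphere_avgZ => E.
have mn1 : 1 <= m%:R + n%:R :> R by rewrite -natrD ler1n lt0n.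
have D2 := hD.
have M0 : 0 < (m + n)%N%:R * ((m + n)%N%:R + d%:R - 2) :> R.
  by rewrite natrD mulr_gt0 //; lra.
apply: (mulfI (lt0r_neq0 M0)); rewrite mulrCA E natrD [RHS]mulrA (gegm_rec HJ) //.
have e2 : m%:R * (m%:R - 1) * (J 1 * sphere_avg (lin x ^+ m.-2 * h)) =
    m%:R * (m%:R - 1) * (gegm d%:R J m.-2 n * mpoly_at x h).
  case: m {E hm mn mn1 M0} IH => [|[|m]] IH; rewrite ?mul0r ?subrr ?mulr0 ?mul0r //.
  by rewrite (IH m _ n).
have e1 : m%:R * (J 1 * sphere_avg (lin x ^+ m.-1 * dirderiv x h)) =
    m%:R * (gegm d%:R J m.-1 n.-1 * (n%:R * mpoly_at x h)).
  case: m {E hm mn mn1 M0 e2} IH => [|m] IH; rewrite ?mul0r //.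
  rewrite (IH m _ n.-1) ?(mpoly_at_dirderiv _ hh) //; first exact: dirderiv_homog.
  exact: dirderiv_harmonic.
transitivity (m%:R * (m%:R - 1) * (J 1 * sphere_avg (lin x ^+ m.-2 * h)) +
    2 * (m%:R * (J 1 * sphere_avg (lin x ^+ m.-1 * dirderiv x h)))); first ring.
by rewrite e2 e1; ring.
Qed.

(** The polynomial phi(<x, y>) in y, with x as a parameter. *)
Definition zonal (phi : {poly R}) x : mpoly d R := (map_poly (@mpolyC d R) phi).[lin x].

Lemma zonalM phi psi x : zonal (phi * psi) x = zonal phi x * zonal psi x.
Proof. by rewrite /zonal rmorphM hornerM. Qed.

Lemma zonalE phi x : zonal phi x = \sum_(m < size phi) phi`_m *: lin x ^+ m.
Proof.
rewrite /zonal (@horner_coef_wide _ (size phi)) ?size_poly //.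
by apply: eq_bigr => m _; rewrite coef_map mul_mpolyC.
Qed.

Lemma funk_hecke x n h phi : sphere d x -> h \is homog n -> laplacian h = 0 ->
  J 1 * sphere_avg (zonal phi x * h) = J (phi * gegP d%:R n) * mpoly_at x h.
Proof.
move=> xS hh h0; rewrite zonalE mulr_suml sphere_avg_sum mulr_sumr.
rewrite (gegf_mul_gegP HJ) mulr_suml; apply: eq_bigr => m _.
by rewrite -scalerAl sphere_avgZ mulrCA (funk_hecke_linX _ xS hh h0) mulrA.
Qed.

End FunkHecke.

(** * Bounds on harmonic components *)

(** Coefficients are recovered from the values at N + 1 points of [0, 1) by the inverse Vandermonde
    matrix, which depends on N only. *)
Lemma coef_bound_exists (R : realType) (N : nat) : exists2 c : R, 0 <= c &
  forall (r : {poly R}) (M : R) j, (size r <= N.+1)%N ->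
    (forall t, `|t| <= 1 -> `|r.[t]| <= M) -> `|r`_j| <= c * M.
Proof.
pose a : 'rV[R]_N.+1 := \row_j (j%:R / N.+1%:R).
pose V := Vandermonde N.+1 a.
have Vu : V \in unitmx.
  rewrite unitmxE det_Vandermonde unitfE; apply/prodf_neq0 => i _.
  apply/prodf_neq0 => j ij; rewrite !mxE -mulrBl mulf_neq0 ?invr_eq0 ?pnatr_eq0 //.
  by rewrite subr_eq0 eqr_nat gtn_eqF.
exists (\sum_j \sum_k `|invmx V k j|).
  by apply: sumr_ge0 => j _; apply: sumr_ge0.
move=> r M j sr rM.
have M0 : 0 <= M by apply: le_trans (rM 0 _); rewrite ?normr0.
have [jN|Nj] := ltnP j N.+1; last first.
  rewrite nth_default ?(leq_trans sr) // normr0 mulr_ge0 //.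
  by apply: sumr_ge0 => k _; apply: sumr_ge0.
pose v : 'rV[R]_N.+1 := \row_k r.[a ord0 k].
pose c : 'rV[R]_N.+1 := \row_k r`_k.
have cV : c *m V = v.
  apply/rowP => k; rewrite !mxE (horner_coef_wide _ sr).
  by apply: eq_bigr => i _; rewrite !mxE.
have -> : r`_j = (v *m invmx V) ord0 (Ordinal jN) by rewrite -cV mulmxK // mxE.
rewrite mxE; apply: le_trans (ler_norm_sum _ _ _) _.
apply: (@le_trans _ _ ((\sum_k `|invmx V k (Ordinal jN)|) * M)).
  rewrite mulr_suml; apply: ler_sum => k _; rewrite normrM mulrC ler_wpM2l // mxE.
  apply: rM; rewrite mxE ger0_norm ?divr_ge0 ?ler0n // ler_pdivrMr ?ltr0n //.
  by rewrite mul1r ler_nat ltnW.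
rewrite ler_wpM2r // [leRHS](bigD1 (Ordinal jN)) //= lerDl.
by apply: sumr_ge0 => k _; apply: sumr_ge0.
Qed.

Section SupNorm.
Variables (R : realType) (d : nat).
Implicit Types (p q g : mpoly d R) (x y : 'rV[R]_d) (i : 'I_d).
Local Notation homog m := (@ishomog1 d R m mdeg).

Lemma sphere_has_ub p : has_ubound [set `|mpoly_at x p| | x in sphere d].
Proof.
exists (\sum_(m <- msupp p) `|mcoeff m p|) => _ [x xS <-].
rewrite /mpoly_at mevalE; apply: le_trans (ler_norm_sum _ _ _) _.
apply: ler_sum => m _; rewrite normrM ler_piMr // normr_prod.
apply: prodr_ile1 => i _; rewrite normr_ge0 normrX exprn_ile1 //.
rewrite -(@expr_le1 _ 2) // real_normK ?num_real // -xS; exact: coord_sqnorm_le.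
Qed.

Lemma supnorm_ub p x : sphere d x -> `|mpoly_at x p| <= supnorm p.
Proof.
by move=> xS; apply: sup_upper_bound; [split; [exists `|mpoly_at x p|; exists x|exact: sphere_has_ub]|exists x].
Qed.

Lemma sphere_polar y : (1 <= d)%N ->
  exists2 x, sphere d x & y = Num.sqrt (sqnorm y) *: x.
Proof.
move=> d1; have [y0|y0] := eqVneq (sqnorm y) 0.
  exists (delta_mx ord0 (Ordinal d1)).
    rewrite /sphere /= /sqnorm (bigD1 (Ordinal d1)) //= big1 ?addr0.
      by rewrite mxE !eqxx expr1n.
    by move=> i ij; rewrite mxE (negPf ij) expr0n.
  rewrite y0 sqrtr0 scale0r; apply/rowP => i; rewrite mxE.
  apply/eqP; rewrite -(sqrf_eq0 (y ord0 i)) eq_le sqr_ge0 andbT -y0.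
  exact: coord_sqnorm_le.
have s0 : 0 < sqnorm y by rewrite lt_neqAle eq_sym y0 sqnorm_ge0.
have r0 : Num.sqrt (sqnorm y) != 0 by rewrite gt_eqF // sqrtr_gt0.
exists ((Num.sqrt (sqnorm y))^-1 *: y); last by rewrite scalerA divff ?scale1r.
rewrite /sphere /= {1}/sqnorm; under eq_bigr do rewrite mxE exprMn.
by rewrite -mulr_sumr exprVn sqr_sqrtr ?sqnorm_ge0 // mulVf.
Qed.

Lemma sphere_neq0 : (1 <= d)%N -> exists x, sphere d x.
Proof. by move=> d1; have [x xS _] := sphere_polar 0 d1; exists x. Qed.

Lemma supnorm_le p M : (1 <= d)%N ->
  (forall x, sphere d x -> `|mpoly_at x p| <= M) -> supnorm p <= M.
Proof.
move=> d1 pM; apply: ge_sup; last by move=> _ [x xS <-]; exact: pM.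
by have [x xS] := sphere_neq0 d1; exists `|mpoly_at x p|; exists x.
Qed.

Lemma supnorm_ge0 p : (1 <= d)%N -> 0 <= supnorm p.
Proof.
by move=> /sphere_neq0[x xS]; apply: le_trans (supnorm_ub p xS).
Qed.

Lemma homog_bound m p y : (1 <= d)%N -> p \is homog m ->
  `|mpoly_at y p| <= Num.sqrt (sqnorm y) ^+ m * supnorm p.
Proof.
move=> d1 hp; have [x xS yE] := sphere_polar y d1.
rewrite {1}yE (homog_scale _ _ hp) normrM ger0_norm ?exprn_ge0 ?sqrtr_ge0 //.
by rewrite ler_wpM2l ?exprn_ge0 ?sqrtr_ge0 // supnorm_ub.
Qed.

Lemma homog_sphere_inj m p q : (1 <= d)%N -> p \is homog m -> q \is homog m ->
  (forall x, sphere d x -> mpoly_at x p = mpoly_at x q) -> p = q.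
Proof.
move=> d1 hp hq pq; apply: mpoly_at_inj => y.
have [x xS ->] := sphere_polar y d1.
by rewrite (homog_scale _ _ hp) (homog_scale _ _ hq) pq.
Qed.

Lemma size_mline m p x i : p \is homog m -> (size (mline x i p) <= m.+1)%N.
Proof.
move=> /dhomogP hp; rewrite /mline /mmap.
apply: leq_trans (size_sum _ _ _) _; rewrite big_seq.
apply/bigmax_leqP_seq => k _ km; rewrite mul_polyC.
apply: leq_trans (size_scale_leq _ _) _; rewrite -(hp k km) /mmap1 /= mdegE.
elim/big_rec2: _ => [|j n q _ IH]; first by rewrite size_poly1.
apply: leq_trans (size_polyMleq _ _) _.
have : (size (((x ord0 j)%:P + (i == j)%:R *: 'X) ^+ k j) <= (k j).+1)%N.
  apply: leq_trans (size_poly_exp_leq _ _) _; rewrite ltnS.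
  have : (size ((x ord0 j)%:P + (i == j)%:R *: 'X : {poly R})%R <= 2)%N.
    apply: leq_trans (size_polyD _ _) _; rewrite geq_max (leq_trans (size_polyC_leq1 _)) //.
    by rewrite (leq_trans (size_scale_leq _ _)) // size_polyX.
  by case: (size _) => [|[|[|]]] //= _; rewrite ?mul0n ?mul1n.
by move=> h; rewrite -subn1 leq_subLR add1n (leq_trans (leq_add h IH)) // addSn addnS.
Qed.

Lemma sqnorm_line_le x i t : sphere d x -> `|t| <= 1 ->
  Num.sqrt (sqnorm (x + t *: delta_mx ord0 i)) <= 2.
Proof.
move=> xS t1; rewrite -(ger0_norm (ler0n R 2)) -sqrtr_sqr ler_wsqrtr // sqnorm_line xS.
have xi : `|x ord0 i| <= 1.
  by rewrite -(@expr_le1 _ 2) // real_normK ?num_real // -xS coord_sqnorm_le.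
have tx : t * x ord0 i <= 1.
  by apply: le_trans (ler_norm _) _; rewrite normrM mulr_ile1.
have t2 : t ^+ 2 <= 1 by rewrite -real_normK ?num_real // exprn_ile1.
lra.
Qed.

Lemma sqn_laplacian_eig (j m : nat) (h : mpoly d R) : h \is homog m -> laplacian h = 0 ->
  @sqn R d * laplacian (@sqn R d ^+ j * h) = lapeig R d j m *: (@sqn R d ^+ j * h).
Proof.
move=> hh h0; rewrite (laplacian_sqnX j hh h0) -scalerAr mulrA -exprS.
by case: j => [|j] //; rewrite /lapeig !(mulr0, mul0r) !scale0r.
Qed.

End SupNorm.

(** Each second derivative is twice a coefficient of g on a line; points with |t| <= 1 there have
    norm at most 2, where |g| <= 2^m times its sup norm. Only the number of coordinates brings in
    d. *)
Lemma laplacian_bound (R : realType) (m : nat) : exists2 C : R, 0 <= C &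
  forall d (g : mpoly d R), (1 <= d)%N -> g \is @ishomog1 d R m mdeg ->
    forall x, sphere d x -> `|mpoly_at x (laplacian g)| <= C * d%:R * supnorm g.
Proof.
have [c c0 hc] := coef_bound_exists R m.
exists (2 * c * 2 ^+ m) => [|d g d1 hg x xS]; first by rewrite !mulr_ge0 ?exprn_ge0.
rewrite /laplacian mpoly_at_sum; apply: le_trans (ler_norm_sum _ _ _) _.
apply: (@le_trans _ _ (\sum_(i < d) 2 * c * 2 ^+ m * supnorm g)); last first.
  by rewrite sumr_const card_ord -[leLHS]mulr_natr [leRHS]mulrAC.
apply: ler_sum => i _; rewrite -mline_coef2 normrMn -[leLHS]mulr_natl -!mulrA.
rewrite ler_pM2l //; apply: hc; first exact: size_mline.
move=> t t1; rewrite mline_horner; apply: le_trans (homog_bound _ d1 hg) _.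
rewrite ler_wpM2r ?supnorm_ge0 // lerXn2r ?nnegrE ?sqrtr_ge0 //.
exact: sqnorm_line_le.
Qed.

Lemma harmonic_bound_exists (R : realType) (n : nat) :
  exists B : R, harmonic_bound n B.
Proof.
have [C C0 hC] := laplacian_bound R (2 * n).
(* L d bounds one factor [sqn * laplacian - mu i]: C accounts for the Laplacian, the rest for |mu
   i|. *)
pose L : R := C + 2 * n%:R * (4 * n%:R + 1).
have L0 : 0 <= L by rewrite addr_ge0 // !mulr_ge0 ?addr_ge0 ?mulr_ge0 ?ler0n.
exists (L ^+ n) => d f h d1 hf [hh fE] k.
have dR : 1 <= d%:R :> R by rewrite ler1n.
pose s : mpoly d R := @sqn R d.
pose e (j : 'I_n.+1) : mpoly d R := s ^+ (n - j) * h j.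
have jn (j : 'I_n.+1) : (j <= n)%N by rewrite -ltnS.
have degE (j : 'I_n.+1) : (2 * (n - j) + 2 * j)%N = (2 * n)%N.
  by rewrite -mulnDr subnK.
have he j : e j \is @ishomog1 d R (2 * n) mdeg.
  by have := sqnX_homog (n - j) (proj1 (hh j)); rewrite degE.
have eS j x : sphere d x -> mpoly_at x (e j) = mpoly_at x (h j).
  by move=> xS; rewrite mpoly_atM mpoly_at_exp mpoly_at_sqn xS expr1n mul1r.
have fE' : f = \sum_j e j.
  apply: (homog_sphere_inj d1 hf); first by apply: rpred_sum => j _; exact: he.
  move=> x xS; rewrite fE // mpoly_at_sum; apply: eq_bigr => j _.
  by rewrite eS.
pose mu (j : 'I_n.+1) : R := lapeig R d (n - j) (2 * j).
have muE j : mu j = 2 * (n%:R - j%:R) * (2 * n%:R + 2 * j%:R + d%:R - 2).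
  by rewrite /mu /lapeig natrB // natrM; ring.
have eig j : s * laplacian (e j) = mu j *: e j.
  by have [h1 h2] := hh j; exact: sqn_laplacian_eig.
have mule j : `|mu j| <= 2 * n%:R * (4 * n%:R + 1) * d%:R.
  rewrite muE; have j0 := ler0n R j; have n0 := ler0n R n.
  have jnR : j%:R <= n%:R :> R by rewrite ler_nat.
  rewrite normrM (@ger0_norm _ (2 * (n%:R - j%:R))); last by lra.
  rewrite -[leRHS]mulrA; apply: ler_pM => //; try lra.
  by rewrite ler_norml; apply/andP; split; nra.
(* The gap is 2 |j - k| (d - 2 + 2 (j + k)), and j + k >= 1 makes up for the -2. *)
have mudiff j : j != k -> d%:R <= `|mu k - mu j|.
  move=> jk; have jkR : (j%:R <= k%:R - 1 :> R) || (k%:R + 1 <= j%:R :> R).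
    rewrite lerBrDr !natr1 !ler_nat -neq_ltn; exact: jk.
  rewrite !muE; have j0 := ler0n R j; have k0 := ler0n R k.
  have -> : 2 * (n%:R - k%:R) * (2 * n%:R + 2 * k%:R + d%:R - 2) -
      2 * (n%:R - j%:R) * (2 * n%:R + 2 * j%:R + d%:R - 2) =
      2 * (j%:R - k%:R) * (d%:R - 2 + 2 * (k%:R + j%:R)) :> R by ring.
  case/orP: jkR => hjk; [rewrite ler_normr; apply/orP; right|rewrite ler_normr; apply/orP; left]; nra.
(* Each factor sqn * laplacian - mu i kills the component i and costs O(d). *)
have iterT (r : seq 'I_n.+1) : exists2 g : mpoly d R,
    g = \sum_j (\prod_(i <- r) (mu j - mu i)) *: e j &
    supnorm g <= (L * d%:R) ^+ size r * supnorm f.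
  elim: r => [|i r [g gE gle]].
    exists f; last by rewrite expr0 mul1r.
    by rewrite fE'; apply: eq_bigr => j _; rewrite big_nil scale1r.
  have hg : g \is @ishomog1 d R (2 * n) mdeg.
    by rewrite gE; apply: rpred_sum => j _; apply: dhomogZ.
  exists (s * laplacian g - mu i *: g).
    rewrite [in X in _ * X]gE laplacian_sum mulr_sumr gE scaler_sumr -sumrB.
    apply: eq_bigr => j _; rewrite laplacianZ -scalerAr eig big_cons !scalerA -scalerBl.
    by congr (_ *: _); ring.
  apply: supnorm_le => // x xS; rewrite /= exprS -mulrA.
  apply: le_trans (ler_wpM2l _ gle); last by rewrite mulr_ge0 ?ler0n.
  rewrite mpoly_atB mpoly_atM mpoly_at_sqn xS mul1r mpoly_atZ.
  apply: le_trans (ler_normB _ _) _.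
  have -> : L * d%:R * supnorm g =
      C * d%:R * supnorm g + 2 * n%:R * (4 * n%:R + 1) * d%:R * supnorm g.
    by rewrite /L; ring.
  apply: lerD; first exact: hC.
  by rewrite normrM; apply: ler_pM => //; exact: supnorm_ub.
(* There are n factors, each costing L d and each scaling the component k by at least d, so the
   powers of d cancel and L^n remains. *)
have [g gE gle] := iterT [seq i <- enum 'I_n.+1 | i != k].
have sz : size [seq i <- enum 'I_n.+1 | i != k] = n.
  rewrite size_filter; have := count_predC (pred1 k) (enum 'I_n.+1).
  by rewrite size_enum_ord count_uniq_mem ?enum_uniq // mem_enum add1n => -[].
set r := [seq i <- _ | _] in gE gle sz.
have gk : g = (\prod_(i <- r) (mu k - mu i)) *: e k.
  rewrite gE (bigD1 k) //= [X in _ + X]big1 ?addr0 // => j jk.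
  have jr : j \in r by rewrite mem_filter jk mem_enum.
  by rewrite (big_rem j jr) /= subrr mul0r scale0r.
have prodge : d%:R ^+ n <= `|\prod_(i <- r) (mu k - mu i)|.
  rewrite -[X in _ ^+ X]sz normr_prod.
  have : all (fun i => i != k) r by apply: filter_all.
  elim: (r) => [|i t IH] /=; first by rewrite big_nil expr0.
  case/andP => ik /IH h1; rewrite big_cons exprS ler_pM ?exprn_ge0 ?ler0n //.
  exact: mudiff.
apply: supnorm_le => // x xS.
have d0 : 0 < d%:R ^+ n :> R by rewrite exprn_gt0 ?ltr0n.
rewrite -(ler_pM2l d0); apply: (@le_trans _ _ `|mpoly_at x g|).
  by rewrite gk mpoly_atZ normrM eS // ler_wpM2r.
apply: le_trans (supnorm_ub g xS) _; apply: le_trans gle _.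
by rewrite sz exprMn mulrA [d%:R ^+ n * _]mulrC.
Qed.

(** Tested on |x|^(2n) in one variable, whose sup norm is positive and whose only component is the
    constant 1. *)
Lemma harmonic_bound_ge0 (R : realType) (n : nat) (B : R) :
  harmonic_bound n B -> 0 <= B.
Proof.
pose s : mpoly 1 R := @sqn R 1 ^+ n.
pose h (k : 'I_n.+1) : mpoly 1 R := (k == ord0)%:R.
have sS x : sphere 1 x -> mpoly_at x s = 1.
  by move=> xS; rewrite mpoly_at_exp mpoly_at_sqn xS expr1n.
have hE : is_harmonic_decomposition s h.
  split=> [k|x xS].
    rewrite /h; case: eqP => [->|_] /=; last by rewrite dhomog0 laplacian0.
    rewrite muln0 dhomog1; split=> //.
    by rewrite /laplacian big1 // => i _; rewrite -mpolyC1 !(mderivC, mderiv0).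
  rewrite sS // /h (bigD1 ord0) //= big1 ?addr0; first by rewrite -mpolyC1 mpoly_atC.
  by move=> i /negPf->; rewrite mpoly_at_0.
have hs : s \is @ishomog1 1 R (2 * n) mdeg by apply: dhomogMn; exact: sqn_homog.
move=> /(_ 1%N s h (leqnn _) hs hE ord0) hB.
have [x xS] := @sphere_neq0 R 1 (leqnn _).
have s1 : 1 <= supnorm s by have := supnorm_ub s xS; rewrite sS // normr1.
have := le_trans (supnorm_ge0 (h ord0) (leqnn _)) hB.
by rewrite pmulr_lge0 // (lt_le_trans ltr01).
Qed.

(** For f nonzero on the sphere, every admissible B exceeds the ratio of the norms, hence so does
    the infimum. For f zero there, any admissible B makes the components vanish. *)
Lemma harmonic_const_bound (R : realType) (n : nat) : harmonic_bound n (harmonic_const R n).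
Proof.
move=> d f h d1 hf hE k.
have [s0|s0] := leP (supnorm f) 0.
  have [B hB] := harmonic_bound_exists R n.
  have sf : supnorm f = 0 by apply: le_anti; rewrite s0 supnorm_ge0.
  by have := hB d f h d1 hf hE k; rewrite sf !mulr0.
rewrite -ler_pdivrMr //; apply: lb_le_inf; first exact: harmonic_bound_exists.
by move=> B hB; rewrite ler_pdivrMr // hB.
Qed.

Lemma harmonic_const_ge0 (R : realType) (n : nat) : 0 <= harmonic_const R n.
Proof.
apply: lb_le_inf; first exact: harmonic_bound_exists.
by move=> B; exact: harmonic_bound_ge0.
Qed.

(** * Sums of squares *)

(* Cholesky elimination: subtracting the rank one kernel of the index i kills
   its row and column and preserves positivity. *)
Lemma psd_kernel_sum (R : realType) (I : finType) (G : I -> I -> R) :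
  (forall a b, G a b = G b a) ->
  (forall c : I -> R, 0 <= \sum_a \sum_b c a * c b * G a b) ->
  exists L : seq (I -> R), forall a b, G a b = \sum_(u <- L) u a * u b.
Proof.
suff H (s : seq I) (G' : I -> I -> R) : (forall a b, G' a b = G' b a) ->
    (forall c : I -> R, 0 <= \sum_a \sum_b c a * c b * G' a b) ->
    (forall a, a \notin s -> forall b, G' a b = 0) ->
    exists L : seq (I -> R), forall a b, G' a b = \sum_(u <- L) u a * u b.
  by move=> sG pG; apply: (H (enum I)) => // a; rewrite mem_enum.
elim: s G' => [|i s IH] {}G sG pG zG.
  by exists [::] => a b; rewrite big_nil zG.
have quad (c : I -> R) t : \sum_a \sum_b (c a + t * (a == i)%:R) * (c b + t * (b == i)%:R) * G a b =
    \sum_a \sum_b c a * c b * G a b + 2 * t * (\sum_b c b * G i b) + t ^+ 2 * G i i.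
  have pick (F : I -> R) : \sum_a (a == i)%:R * F a = F i.
    rewrite (bigD1 i) //= eqxx mul1r big1 ?addr0 // => a /negPf->.
    by rewrite mul0r.
  transitivity (\sum_a (\sum_b c a * c b * G a b + t * (c a * G i a) +
      (a == i)%:R * (t * (\sum_b c b * G a b) + t ^+ 2 * G a i))).
    apply: eq_bigr => a _.
    transitivity (\sum_b (c a * c b * G a b + (b == i)%:R * (t * (c a * G a b)) +
        (a == i)%:R * (t * (c b * G a b) + (b == i)%:R * (t ^+ 2 * G a b)))).
      by apply: eq_bigr => b _; ring.
    rewrite !big_split /= pick (sG a i) -mulr_sumr; congr (_ + _ + _ * _).
    by rewrite big_split /= pick mulr_sumr (sG a i).
  by rewrite !big_split /= pick -mulr_sumr; ring.
have Gii : 0 <= G i i.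
  have := pG (fun a => 0 + 1 * (a == i)%:R); rewrite quad.
  rewrite big1 => [|a _]; last by rewrite big1 // => b _; rewrite !mul0r.
  by rewrite big1 => [|b _]; rewrite ?mul0r // mulr0 !add0r expr1n mul1r.
have [G0|G1] := eqVneq (G i i) 0.
  have Gi b : G i b = 0.
    apply/eqP/negPn/negP => ib.
    pose c a : R := (a == b)%:R.
    have cb : \sum_a c a * G i a = G i b.
      rewrite (bigD1 b) //= /c eqxx mul1r big1 ?addr0 // => a /negPf->.
      by rewrite mul0r.
    (* With a zero diagonal entry the form is affine in the coordinate i; this choice gives it the
       value -1. *)
    have := pG (fun a => c a + (- (\sum_a \sum_b c a * c b * G a b + 1) / (2 * G i b)) * (a == i)%:R).
    rewrite quad cb G0 mulr0 addr0; set S := \sum_a _.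
    have -> : S + 2 * (- (S + 1) / (2 * G i b)) * G i b = -1 by field.
    lra.
  apply: (IH G) => // a as' b; have [->|ai] := eqVneq a i; first exact: Gi.
  by apply: zG; rewrite inE negb_or ai.
have {G1 Gii} Gp : 0 < G i i by rewrite lt_neqAle eq_sym G1.
pose G2 a b := G a b - G i a * G i b / G i i.
have [|c|a as' b|L hL] := IH G2.
- by move=> a b; rewrite /G2 (sG a b) [G i a * _]mulrC.
(* The minimizer of the form over the coordinate i; the minimum is the form of [G2]. *)
- have := pG (fun a => c a + (- (\sum_b c b * G i b) / G i i) * (a == i)%:R).
  rewrite quad; set T := \sum_b c b * G i b.
  have -> : \sum_a \sum_b c a * c b * G2 a b =
      \sum_a \sum_b c a * c b * G a b - T ^+ 2 / G i i.
    rewrite expr2 {1}/T mulr_suml mulr_suml -sumrB; apply: eq_bigr => a _.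
    rewrite /T !mulr_sumr mulr_suml -sumrB; apply: eq_bigr => b _.
    by rewrite /G2; ring.
  set S := \sum_a _.
  have -> : S + 2 * (- T / G i i) * T + (- T / G i i) ^+ 2 * G i i = S - T ^+ 2 / G i i.
    by field; exact: lt0r_neq0.
  by [].
- rewrite /G2; have [->|ai] := eqVneq a i.
    by rewrite mulrAC divff ?mul1r ?subrr // lt0r_neq0.
  have ais : a \notin i :: s by rewrite inE negb_or ai.
  by rewrite (sG i a) !(zG a ais) !mul0r subrr.
pose r := Num.sqrt (G i i); have r2 : r * r = G i i by rewrite -expr2 sqr_sqrtr // ltW.
have r0 : r != 0 by rewrite gt_eqF // sqrtr_gt0.
exists ((fun a => G i a / r) :: L) => a b.
by rewrite big_cons -hL /G2 -r2; field.
Qed.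

Section ZonalTensor.
Variables (R : realType) (d : nat).

Lemma msize_mul_X (p : mpoly d R) i m : (msize p <= m)%N ->
  (msize (@mpolyX d R (mnm1 i) * p) <= m.+1)%N.
Proof.
have [->|p0] := eqVneq p 0; first by rewrite mulr0 mmeasure0.
by rewrite msizeM ?msizeX ?mdeg1 // -(mmeasure_poly_eq0 mdeg) mmeasureX.
Qed.

(** Expands <x, y>^m into products u(x) v(y). Only the degree of u is recorded, since y gets
    averaged out. *)
Lemma linX_tensor m : exists T : seq (mpoly d R * mpoly d R),
  (forall t, t \in T -> (msize t.1 <= m.+1)%N) /\
  forall x : 'rV[R]_d, lin x ^+ m = \sum_(t <- T) mpoly_at x t.1 *: t.2.
Proof.
elim: m => [|m [T [sT hT]]].
  exists [:: (1, 1)]; split=> [t|x].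
    by rewrite inE => /eqP->; rewrite /= msize1.
  by rewrite big_seq1 expr0 -mpolyC1 mpoly_atC scale1r.
exists [seq (@mpolyX d R (mnm1 i) * t.1, @mpolyX d R (mnm1 i) * t.2) | i <- enum 'I_d, t <- T].
split=> [t /allpairsP[[i u] /= [_ uT ->]]|x].
  by apply: msize_mul_X; exact: sT.
rewrite exprS hT big_allpairs_dep big_enum /= /lin mulr_suml; apply: eq_bigr => i _.
rewrite mulr_sumr; apply: eq_bigr => t _.
by rewrite mpoly_atM mpoly_at_X -scalerAr -scalerAl scalerA mulrC.
Qed.

Lemma zonal_tensor (q : {poly R}) l : (size q <= l.+1)%N ->
  exists T : seq (mpoly d R * mpoly d R),
  (forall t, t \in T -> (msize t.1 <= l.+1)%N) /\
  forall x : 'rV[R]_d, zonal q x = \sum_(t <- T) mpoly_at x t.1 *: t.2.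
Proof.
move=> sq; suff H n : (n <= l.+1)%N -> exists T : seq (mpoly d R * mpoly d R),
    (forall t, t \in T -> (msize t.1 <= l.+1)%N) /\
    forall x : 'rV[R]_d, \sum_(m < n) q`_m *: lin x ^+ m =
      \sum_(t <- T) mpoly_at x t.1 *: t.2.
  by have [T [sT hT]] := H _ sq; exists T; split=> // x; rewrite zonalE hT.
elim: n => [|n IH] nl.
  by exists [::]; split=> // x; rewrite big_ord0 big_nil.
have [T [sT hT]] := IH (ltnW nl); have [T' [sT' hT']] := linX_tensor n.
exists (T ++ [seq (t.1, q`_n *: t.2) | t <- T']); split=> [t|x].
  rewrite mem_cat => /orP[/sT //|/mapP[u uT ->]] /=.
  exact: leq_trans (sT' _ uT) nl.
rewrite big_ord_recr /= hT hT' big_cat big_map /=; congr (_ + _).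
rewrite scaler_sumr; apply: eq_bigr => t _.
by rewrite !scalerA mulrC.
Qed.

End ZonalTensor.

(** * Existence of an optimal polynomial q *)

Section RhoAttained.
Variables (R : realType) (d l : nat).
Hypothesis hd : (2 <= d)%N.
Local Notation J := (gegenbauer_int d : {poly R} -> R).
Local Notation P := (gegP (d%:R : R)).
Local Notation c := (sphere_area R d.-1 / sphere_area R d).

Let hD : 2 <= d%:R :> R. Proof. by rewrite ler_nat. Qed.
Let HJ := @gegenbauer_int_functional R d hd.

Definition of_coords (v : 'rV[R]_l.+1) : {poly R} := \sum_(j < l.+1) v ord0 j *: P j.

(* The Gegenbauer coefficients of q ^+ 2 as quadratic forms in the coordinates
   of q; being polynomials, they are continuous. *)
Definition coef_form (i : nat) : mpoly l.+1 R :=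
  \sum_(a < l.+1) \sum_(b < l.+1) (c * J (P a * P b * P i)) *:
    (@mpolyX l.+1 R (mnm1 a) * @mpolyX l.+1 R (mnm1 b)).

Lemma coef_formE v i :
  mpoly_at v (coef_form i) = gegenbauer_coef d (of_coords v ^+ 2) i.
Proof.
rewrite gegenbauer_coefE // /coef_form mpoly_at_sum expr2 /of_coords.
rewrite mulr_suml mulr_suml (gegf_sum HJ) mulr_sumr; apply: eq_bigr => a _.
rewrite mpoly_at_sum mulr_sumr mulr_suml (gegf_sum HJ) mulr_sumr; apply: eq_bigr => b _.
have -> : v ord0 a *: P a * (v ord0 b *: P b) * P i =
    (v ord0 a * v ord0 b) *: (P a * P b * P i).
  by rewrite -!scalerAl -!scalerAr -!scalerAl scalerA.
by rewrite (gegfZ HJ) mpoly_atZ mpoly_atM !mpoly_at_X; ring.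
Qed.

Lemma of_coords_onto (q : {poly R}) : (size q <= l.+1)%N -> exists v, q = of_coords v.
Proof.
move=> sq; have [e ->] := poly_basis (fun i => proj1 (size_gegP hD i)) sq.
exists (\row_j e j); rewrite /of_coords; apply: eq_bigr => j _.
by rewrite mxE.
Qed.

Lemma size_of_coords v : (size (of_coords v) <= l.+1)%N.
Proof.
apply: leq_trans (size_sum _ _ _) _; apply/bigmax_leqP => i _.
by rewrite (leq_trans (size_scale_leq _ _)) // (proj1 (size_gegP hD _)).
Qed.

(** By orthogonality lambda_0 is a positive diagonal quadratic form in the coordinates, so lambda_0
    = 1 bounds them. *)
Lemma compact_admissible (n : nat) (e : R) :
  compact [set v : 'rV[R]_l.+1 | mpoly_at v (coef_form 0) = 1 /\
    forall k : 'I_n.+1, e <= `|mpoly_at v (coef_form (2 * k))|].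
Proof.
pose w (j : nat) : R := c * J (P j ^+ 2).
have w0 j : 0 < w j by rewrite mulr_gt0 ?area_ratio_gt0 ?(gegP_norm_gt0 HJ).
(* A bound on |v_j| from v_j^2 <= 1/w_j without square roots: a <= (a + 1)^2 for a >= 0. *)
pose r (j : 'I_l.+1) := (w j)^-1 + 1.
have c1 := @rV_compact R l.+1 (fun j => [set` `[- r j, r j]]) (fun j => @segment_compact R _ _).
apply: (subclosed_compact _ c1).
  rewrite (_ : [set v | _] = (fun v => mpoly_at v (coef_form 0)) @^-1` [set 1] `&`
    \bigcap_(k in [set: 'I_n.+1]) (fun v => `|mpoly_at v (coef_form (2 * k))|) @^-1` [set t | e <= t]).
    apply: closedI.
      by apply: closed_comp => [x _|]; [exact: continuous_mpoly_at|exact: closed_eq].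
    apply: closed_bigI => k _; apply: closed_comp => [x _|]; last exact: closed_ge.
    apply: (@continuous_comp _ _ _ (fun v => mpoly_at v (coef_form (2 * k))) Num.norm).
      exact: continuous_mpoly_at.
    exact: norm_continuous.
  by apply/seteqP; split=> v [h1 h2]; split=> // k; [move=> _|]; exact: h2.
move=> v [v1 _] j /=; rewrite in_itv /= -ler_norml.
have : w j * v ord0 j ^+ 2 <= 1.
  rewrite -v1 coef_formE gegenbauer_coefE // gegP0 mulr1 /of_coords.
  rewrite (eq_bigr (fun k : 'I_l.+1 => v ord0 (inord k) *: P k)) => [|k _]; last by rewrite inord_val.
  rewrite (gegf_sqr_basis HJ hD _ (fun k : nat => v ord0 (inord k))) mulr_sumr.
  rewrite (bigD1 j) //= inord_val [c * _]mulrCA -/(w j) mulrC lerDl sumr_ge0 // => k _.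
  by rewrite mulrCA mulr_ge0 ?sqr_ge0 // ltW // w0.
move=> h; have wj := w0 j.
have h2 : v ord0 j ^+ 2 <= (w j)^-1 by rewrite -[_^-1]mulr1 mulrC ler_pdivlMr // mulrC.
have wi : 0 < (w j)^-1 by rewrite invr_gt0.
rewrite -[leLHS]ger0_norm // -ler_sqr ?nnegrE ?normr_ge0 //; last by rewrite /r; lra.
rewrite normr_id real_normK ?num_real // /r; nra.
Qed.

Lemma inv_deviation_ge0 (a : R) : (0 <= inv_deviation a)%E.
Proof. by rewrite /inv_deviation; case: ifP => // _; rewrite lee_fin. Qed.

(** The maximum with e removes the poles; where the coefficients are at least e in absolute value,
    the sum is the objective itself. *)
Lemma continuous_deviation (n : nat) (e : R) : 0 < e ->
  continuous (fun v : 'rV[R]_l.+1 => \sum_(1 <= k < n.+1)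
    `|1 - mpoly_at v (coef_form (2 * k))| /
    Num.max `|mpoly_at v (coef_form (2 * k))| e).
Proof.
move=> e0; apply: continuous_big => [|k _ v]; first exact: add_continuous.
have cv := @continuous_mpoly_at R l.+1 (coef_form (2 * k)) v.
have c1 : {for v, continuous (fun x : 'rV[R]_l.+1 => `|1 - mpoly_at x (coef_form (2 * k))|)}.
  apply: (@continuous_comp _ _ _ (fun x => 1 - mpoly_at x (coef_form (2 * k))) Num.norm).
    by apply: continuousB; [exact: cst_continuous|exact: cv].
  exact: norm_continuous.
have c2 : {for v, continuous ((fun x : 'rV[R]_l.+1 => `|mpoly_at x (coef_form (2 * k))|) \max cst e)}.
  apply: continuous_max; last exact: cst_continuous.
  apply: (@continuous_comp _ _ _ (fun x => mpoly_at x (coef_form (2 * k))) Num.norm) => //.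
  exact: norm_continuous.
apply: (continuousM c1); apply: (continuousV (s := _ \max _) _ c2).
by rewrite /= gt_eqF // lt_max e0 orbT.
Qed.

Lemma rho_attained n : (rho R n d l < +oo)%E -> exists q : {poly R},
  [/\ (size q <= l.+1)%N, gegenbauer_coef d (q ^+ 2) 0%N = 1,
   forall k, (1 <= k <= n)%N -> gegenbauer_coef d (q ^+ 2) (2 * k)%N != 0 &
   \sum_(1 <= k < n.+1) `|(gegenbauer_coef d (q ^+ 2) (2 * k)%N)^-1 - 1| <=
     fine (rho R n d l)].
Proof.
pose obj (q : {poly R}) :=
  (\sum_(1 <= k < n.+1) inv_deviation (gegenbauer_coef d (q ^+ 2) (2 * k)%N))%E.
pose S := [set q : {poly R} | (size q <= l.+1)%N /\ gegenbauer_coef d (q ^+ 2) 0%N = 1].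
have rhoE : rho R n d l = ereal_inf [set obj q | q in S] by [].
have obj_ge q k : (1 <= k <= n)%N ->
    (inv_deviation (gegenbauer_coef d (q ^+ 2) (2 * k)%N) <= obj q)%E.
  move=> kn; rewrite /obj (big_rem k) /=; last by rewrite mem_index_iota ltnS.
  by rewrite leeDl // sume_ge0 // => j _; exact: inv_deviation_ge0.
have rho0 : (0 <= rho R n d l)%E.
  rewrite rhoE; apply: le_ereal_inf_tmp => _ [q _ <-].
  by apply: sume_ge0 => j _; exact: inv_deviation_ge0.
move=> rhooo; have rhof : rho R n d l \is a fin_num by rewrite ge0_fin_numE.
pose r := fine (rho R n d l); have rE : rho R n d l = r%:E by rewrite fineK.
have r0 : 0 <= r by rewrite -lee_fin -rE.
(* Chosen so that 0 < |a| < e gives |1/a - 1| >= |1/a| - 1 > r + 1. *)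
pose e := (r + 2)^-1; have e0 : 0 < e by rewrite invr_gt0; lra.
pose g (v : 'rV[R]_l.+1) := \sum_(1 <= k < n.+1)
    `|1 - mpoly_at v (coef_form (2 * k))| / Num.max `|mpoly_at v (coef_form (2 * k))| e.
pose K := [set v : 'rV[R]_l.+1 | mpoly_at v (coef_form 0) = 1 /\
    forall k : 'I_n.+1, e <= `|mpoly_at v (coef_form (2 * k))|].
(* Off K the objective is at least r + 1, so it is enough to minimize over K,
   where it agrees with the continuous function g. *)
have small (a : R) : `|a| < e -> ((r + 1)%:E <= inv_deviation a)%E.
  rewrite /inv_deviation; case: eqP => [_ _|/eqP a0 ae]; first exact: leey.
  have an : 0 < `|a| by rewrite normr_gt0.
  have ai : r + 2 < `|a|^-1 by rewrite -[r + 2]invrK ltf_pV2 ?posrE // invr_gt0; lra.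
  rewrite lee_fin; apply: le_trans (lerB_dist _ _); rewrite normfV normr1; lra.
have dev (a : R) : e <= `|a| -> inv_deviation a = (`|1 - a| / Num.max `|a| e)%:E.
  move=> ae; have an : a != 0 by rewrite -normr_gt0 (lt_le_trans e0).
  rewrite /inv_deviation (negPf an) max_l //; congr EFin.
  by rewrite -normfV -normrM; congr Num.norm; field.
have gE v : K v -> obj (of_coords v) = (g v)%:E.
  move=> [_ Kv]; rewrite /obj /g -sumEFin !big_seq; apply: eq_bigr => k.
  rewrite mem_index_iota => /andP[_ kn].
  by rewrite -coef_formE dev //; exact: (Kv (Ordinal kn)).
have notK v : S (of_coords v) -> ~ K v -> ((r + 1)%:E <= obj (of_coords v))%E.
  move=> [_ s1] nK; have [k [kn kl]] : exists k, (1 <= k <= n)%N /\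
      `|mpoly_at v (coef_form (2 * k))| < e.
    apply: contrapT => h; apply: nK; split; first by rewrite coef_formE.
    move=> k; rewrite leNgt; apply/negP => ke; apply: h; exists k; split=> //.
    (* The failing index is not 0, because lambda_0 = 1 exceeds e. *)
    rewrite -[(k <= n)%N]ltnS ltn_ord andbT lt0n; apply/eqP => k0; move: ke.
    rewrite k0 muln0 coef_formE s1 normr1 /e => /lt_le_trans - /(_ _ (lexx _)).
    by rewrite ltNge invf_le1; [move/negP; apply; lra|lra].
  by apply: le_trans (obj_ge _ _ kn); apply: small; rewrite -coef_formE.
have [q1 [S1 q1r]] : exists q, S q /\ (obj q < (r + 1)%:E)%E.
  have : (ereal_inf [set obj q | q in S] < (r + 1)%:E)%E.
    by rewrite -rhoE rE lte_fin; lra.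
  by case/ereal_inf_lt => _ [q Sq <-] h; exists q.
have [v1 v1E] := of_coords_onto S1.1.
have K1 : K v1.
  apply: contrapT => nK; have := notK v1; rewrite -v1E => /(_ S1 nK).
  by rewrite leNgt q1r.
have [||u cK cmin] := EVT_min_rV (f := g) _ (@compact_admissible n e) _.
- by exists v1.
- exact/continuous_subspaceT/continuous_deviation.
rewrite inE in cK.
have Sc : S (of_coords u).
  by split; [exact: size_of_coords|rewrite -coef_formE; case: cK].
have gle : (obj (of_coords u) <= rho R n d l)%E.
  rewrite rhoE; apply: le_ereal_inf_tmp => _ [q Sq <-].
  have [v vE] := of_coords_onto Sq.1; rewrite vE in Sq *.
  have [Kv|nK] := pselect (K v).
    by rewrite !gE // lee_fin; apply: cmin; rewrite inE.
  apply: le_trans (notK _ Sq nK); rewrite gE //; apply: le_trans (ltW q1r).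
  by rewrite v1E gE // lee_fin; apply: cmin; rewrite inE.
have nz k : (1 <= k <= n)%N -> gegenbauer_coef d (of_coords u ^+ 2) (2 * k)%N != 0.
  move=> /andP[_ kn]; rewrite -coef_formE -normr_gt0 (lt_le_trans e0) //.
  by have [_ h] := cK; exact: (h (Ordinal (kn : (k < n.+1)%N))).
exists (of_coords u); split=> //; try by case: Sc.
rewrite -lee_fin fineK //; apply: le_trans gle; rewrite /obj -sumEFin !big_seq.
apply: lee_sum => k; rewrite mem_index_iota ltnS => kn.
by rewrite /inv_deviation (negPf (nz k kn)).
Qed.

End RhoAttained.

Lemma harmonic_decomposition_even (R : realType) (n d : nat) (p : mpoly d R) :
  (1 <= d)%N -> p \is @ishomog1 d R (2 * n)%N mdeg ->
  exists h : 'I_n.+1 -> mpoly d R, is_harmonic_decomposition p h.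
Proof.
move=> d1 hp; have [h [hh pE]] := harmonic_decomposition d1 hp.
exists (fun k : 'I_n.+1 => h (n - k)%N); split=> [k|x xS].
  have [h1 h2] := hh (n - k)%N; split=> //.
  by move: h1; rewrite -mulnBr subKn // -ltnS.
rewrite pE mul2n doubleK mpoly_at_sum (reindex_inj rev_ord_inj) /=.
apply: eq_bigr => k _.
by rewrite subSS mpoly_atM mpoly_at_exp mpoly_at_sqn xS expr1n mul1r.
Qed.

Lemma quadform_sum (R : realType) k (A : 'M[R]_k) (w : 'I_k -> R) :
  ((\col_a w a)^T *m A *m (\col_a w a)) ord0 ord0 =
  \sum_a \sum_b w a * w b * A a b.
Proof.
rewrite mxE exchange_big /=; apply: eq_bigr => b _.
rewrite !mxE mulr_suml; apply: eq_bigr => a _.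
by rewrite !mxE mulrAC.
Qed.

Lemma sphere_avg_bilinear (R : realType) (d : nat) (I : finType) (x y : I -> R)
    (v : I -> mpoly d R) p :
  sphere_avg ((\sum_i x i *: v i) * (\sum_j y j *: v j) * p) =
  \sum_i \sum_j x i * y j * sphere_avg (v i * v j * p).
Proof.
rewrite !mulr_suml sphere_avg_sum; apply: eq_bigr => i _.
rewrite mulr_sumr mulr_suml sphere_avg_sum; apply: eq_bigr => j _.
have -> : x i *: v i * (y j *: v j) * p = (x i * y j) *: (v i * v j * p).
  by rewrite -(scalerAl (x i)) -scalerAr scalerA -scalerAl.
exact: sphere_avgZ.
Qed.

(** * The sum-of-squares representation *)

Section MatrixSosProof.
Variables (R : realType) (n d k l : nat) (F : 'M[mpoly d R]_k).
Hypothesis hd : (2 <= d)%N.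
Hypothesis Fsym : F^T = F.
Hypothesis Fhom : forall i j, F i j \is @ishomog1 d R (2 * n)%N mdeg.
Hypothesis F01 : forall x, sphere d x ->
  loewner_le 0 (mx_at x F) /\ loewner_le (mx_at x F) 1%:M.

Local Notation B := (harmonic_const R n).

Lemma quadform01 (w : 'I_k -> R) x : sphere d x ->
  0 <= \sum_a \sum_b w a * w b * mpoly_at x (F a b) <= \sum_a w a ^+ 2.
Proof.
move=> /F01[[_ h0] [_ h1]]; apply/andP; split.
  have := h0 (\col_a w a); rewrite quadform_sum.
  by under eq_bigr do under eq_bigr do rewrite subr0 mxE.
rewrite -subr_ge0; have := h1 (\col_a w a); rewrite quadform_sum.
congr (0 <= _); rewrite -sumrB; apply: eq_bigr => a _.
transitivity (\sum_b (w a * w b * (a == b)%:R - w a * w b * mpoly_at x (F a b))).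
  by apply: eq_bigr => b _; rewrite !mxE mulrBr.
rewrite sumrB; congr (_ - _); rewrite (bigD1 a) //= eqxx mulr1 big1 ?addr0 // => b ba.
by rewrite eq_sym (negPf ba) mulr0.
Qed.

(** The scalar bound B is applied to w^T F w - (|w|^2 / 2) |x|^(2n), with values in
    [-|w|^2 / 2, |w|^2 / 2] on the sphere. The correction is homogeneous of degree 2n and alters
    only the component of degree 0, excluded here. *)
Lemma harmonic_quadform_bound (h : 'I_k -> 'I_k -> 'I_n.+1 -> mpoly d R)
    (w : 'I_k -> R) (t : 'I_n.+1) x :
  (forall a b, is_harmonic_decomposition (F a b) (h a b)) -> sphere d x ->
  t != ord0 ->
  `|\sum_a \sum_b w a * w b * mpoly_at x (h a b t)| <= B / 2 * \sum_a w a ^+ 2.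
Proof.
move=> hh xS t0; pose N := \sum_a w a ^+ 2.
have d1 : (1 <= d)%N by exact: ltnW.
pose f : mpoly d R := \sum_a \sum_b (w a * w b) *: F a b - (N / 2) *: @sqn R d ^+ n.
pose g (s : 'I_n.+1) : mpoly d R :=
  \sum_a \sum_b (w a * w b) *: h a b s - mpolyC d (N / 2 * (s == ord0)%:R).
have hf : f \is @ishomog1 d R (2 * n)%N mdeg.
  apply: rpredB; last by apply: dhomogZ; apply: dhomogMn; exact: sqn_homog.
  by apply: rpred_sum => a _; apply: rpred_sum => b _; apply: dhomogZ.
have fE y : mpoly_at y f =
    \sum_a \sum_b w a * w b * mpoly_at y (F a b) - N / 2 * sqnorm y ^+ n.
  rewrite mpoly_atB mpoly_atZ mpoly_at_exp mpoly_at_sqn mpoly_at_sum.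
  congr (_ - _); apply: eq_bigr => a _; rewrite mpoly_at_sum; apply: eq_bigr => b _.
  by rewrite mpoly_atZ.
have gE y s : mpoly_at y (g s) =
    \sum_a \sum_b w a * w b * mpoly_at y (h a b s) - N / 2 * (s == ord0)%:R.
  rewrite mpoly_atB mpoly_atC mpoly_at_sum.
  congr (_ - _); apply: eq_bigr => a _; rewrite mpoly_at_sum; apply: eq_bigr => b _.
  by rewrite mpoly_atZ.
have fg : is_harmonic_decomposition f g.
  split=> [s|y yS].
    split.
      apply: rpredB.
        apply: rpred_sum => a _; apply: rpred_sum => b _; apply: dhomogZ.
        by case: (hh a b) => /(_ s)[].
      case: eqP => [->|_]; last by rewrite mulr0 mpolyC0 dhomog0.
      by rewrite muln0 mulr1 -[mpolyC _ _]mulr1 mul_mpolyC; apply: dhomogZ; exact: dhomog1.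
    rewrite laplacianB !laplacian_sum big1 => [|a _].
      by rewrite /laplacian big1 ?subrr // => i _; rewrite mderivC mderiv0.
    rewrite laplacian_sum big1 // => b _; rewrite laplacianZ.
    by case: (hh a b) => /(_ s)[_ ->] _; rewrite scaler0.
  rewrite fE (yS : sqnorm y = 1) expr1n mulr1 (eq_bigr _ (fun s _ => gE y s)) sumrB.
  congr (_ - _); last first.
    rewrite (bigD1 (ord0 : 'I_n.+1)) //= mulr1 big1 ?addr0 // => s /negPf->.
    by rewrite mulr0.
  rewrite [RHS]exchange_big /=; apply: eq_bigr => a _.
  rewrite [RHS]exchange_big /=; apply: eq_bigr => b _.
  by case: (hh a b) => _ ->; rewrite // mulr_sumr.
have fN : supnorm f <= N / 2.
  apply: supnorm_le => // y yS; rewrite fE (yS : sqnorm y = 1) expr1n mulr1.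
  have /andP[q0 q1] := quadform01 w yS; rewrite -/N in q1.
  by rewrite ler_norml; apply/andP; split; lra.
have := supnorm_ub (g t) xS; rewrite gE (negPf t0) mulr0 subr0 => /le_trans; apply.
apply: le_trans (harmonic_const_bound d1 hf fg t) _.
by rewrite -mulrA ler_wpM2l ?harmonic_const_ge0 // mulrC.
Qed.

Lemma sos_of_rho : (0 < k)%N -> (rho R n d l < +oo)%E ->
  is_sos l (F + (mpolyC d (B / 2 * fine (rho R n d l)))%:M).
Proof.
move=> k0 rhooo; have d1 : (1 <= d)%N by exact: ltnW.
have [q [sq q0 qnz qrho]] := rho_attained hd rhooo.
set rr := fine _ in qrho *; pose delta := B / 2 * rr.
have HJ := gegenbauer_int_functional R hd.
have c0 := area_ratio_gt0 R d; set c := _ / _ in c0.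
pose r := c * gegenbauer_int d (1 : {poly R}).
have r0 : 0 < r by rewrite mulr_gt0 // (gegf_gt0 HJ).
pose lam i := gegenbauer_coef d (q ^+ 2) i.
have FH x m h : sphere d x -> h \is @ishomog1 d R m mdeg -> laplacian h = 0 ->
    r * sphere_avg (zonal (q ^+ 2) x * h) = lam m * mpoly_at x h.
  move=> xS hh h0; rewrite /r -mulrA (funk_hecke hd HJ _ xS hh h0) mulrA.
  by rewrite /lam gegenbauer_coefE.
(* Choosing the decomposition as a function of the polynomial, not of the matrix position, makes it
   symmetric in a and b; 0 is a default off the homogeneous polynomials. *)
have /choice[H hH] : forall p : mpoly d R, exists h : 'I_n.+1 -> mpoly d R,
    p \is @ishomog1 d R (2 * n)%N mdeg -> is_harmonic_decomposition p h.
  move=> p; have [hp|hp] := pselect (p \is @ishomog1 d R (2 * n)%N mdeg).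
    by have [h hh] := harmonic_decomposition_even d1 hp; exists h.
  by exists (fun=> 0).
pose h a b := H (F a b).
have hh a b : is_harmonic_decomposition (F a b) (h a b) by exact: hH.
have hsym a b : h a b = h b a by rewrite /h -{1}Fsym mxE.
pose mu (t : 'I_n.+1) : R := (lam (2 * t)%N)^-1.
have mu0 : mu ord0 = 1 by rewrite /mu muln0 /lam q0 invr1.
have mulam t : mu t * lam (2 * t)%N = 1.
  rewrite /mu mulVf //; have [->|t0] := posnP t; first by rewrite muln0 /lam q0 oner_eq0.
  by apply: qnz; rewrite t0 -ltnS ltn_ord.
pose HH a b : mpoly d R :=
  \sum_t mu t *: h a b t + mpolyC d (delta * (a == b)%:R).
have claimA x a b : sphere d x ->
    r * sphere_avg (zonal (q ^+ 2) x * HH a b) = mpoly_at x (F a b) + delta * (a == b)%:R.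
  move=> xS; rewrite /HH mulrDr sphere_avgD mulrDr; congr (_ + _).
    rewrite [zonal _ _ * _]mulr_sumr sphere_avg_sum mulr_sumr (proj2 (hh a b)) //.
    apply: eq_bigr => t _; have [h1 h2] := proj1 (hh a b) t.
    by rewrite -scalerAr sphere_avgZ mulrCA (FH _ _ _ xS h1 h2) mulrA mulam mul1r.
  rewrite (FH x 0%N) // ?mpoly_atC ?/lam ?q0 ?mul1r //.
    by rewrite -[mpolyC _ _]mulr1 mul_mpolyC; apply: dhomogZ; exact: dhomog1.
  by rewrite /laplacian big1 // => i _; rewrite mderivC mderiv0.
have claimB y (w : 'I_k -> R) : sphere d y ->
    0 <= \sum_a \sum_b w a * w b * mpoly_at y (HH a b).
  move=> yS; pose N := \sum_a w a ^+ 2.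
  have N0 : 0 <= N by apply: sumr_ge0 => a _; exact: sqr_ge0.
  pose Q t := \sum_a \sum_b w a * w b * mpoly_at y (h a b t).
  have -> : \sum_a \sum_b w a * w b * mpoly_at y (HH a b) = \sum_t mu t * Q t + delta * N.
    transitivity (\sum_a \sum_b (\sum_t mu t * (w a * w b * mpoly_at y (h a b t)) +
        delta * (w a * w b * (a == b)%:R))).
      apply: eq_bigr => a _; apply: eq_bigr => b _.
      rewrite mpoly_atD mpoly_atC mpoly_at_sum mulrDr mulr_sumr; congr (_ + _); last ring.
      by apply: eq_bigr => t _; rewrite mpoly_atZ; ring.
    under eq_bigr do rewrite big_split /=.
    rewrite big_split /=; congr (_ + _).
      rewrite (eq_bigr (fun a => \sum_t mu t * \sum_b w a * w b * mpoly_at y (h a b t))).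
        rewrite exchange_big /=; apply: eq_bigr => t _.
        by rewrite mulr_sumr.
      move=> a _; rewrite exchange_big /=; apply: eq_bigr => t _.
      by rewrite mulr_sumr.
    rewrite mulr_sumr; apply: eq_bigr => a _; rewrite -mulr_sumr; congr (_ * _).
    rewrite (bigD1 a) //= eqxx mulr1 -expr2 big1 ?addr0 // => b ba.
    by rewrite eq_sym (negPf ba) mulr0.
  have Q0 : 0 <= \sum_t Q t.
    have /andP[+ _] := quadform01 w yS; congr (0 <= _).
    rewrite [RHS]exchange_big /=; apply: eq_bigr => a _.
    rewrite [RHS]exchange_big /=; apply: eq_bigr => b _.
    by rewrite (proj2 (hh a b)) // mulr_sumr.
  have -> : \sum_t mu t * Q t = \sum_t Q t + \sum_t (mu t - 1) * Q t.
    by rewrite -big_split /=; apply: eq_bigr => t _; ring.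
  (* The factor mu t - 1 vanishes at t = 0, the degree that [harmonic_quadform_bound] leaves out. *)
  have dev : `|\sum_t (mu t - 1) * Q t| <= delta * N.
    rewrite (bigD1 ord0) //= mu0 subrr mul0r add0r.
    apply: le_trans (ler_norm_sum _ _ _) _.
    apply: (@le_trans _ _ (\sum_(t : 'I_n.+1 | t != ord0) `|mu t - 1| * (B / 2 * N))).
      apply: ler_sum => t t0; rewrite normrM ler_wpM2l //.
      exact: harmonic_quadform_bound hh yS t0.
    rewrite -mulr_suml /delta mulrC [leRHS]mulrAC ler_wpM2l //.
      by rewrite !mulr_ge0 ?harmonic_const_ge0 // invr_ge0.
    apply: le_trans qrho; rewrite big_add1 /= big_mkord.
    rewrite big_mkcond big_ord_recl /= add0r; apply: ler_sum => t _.
    by rewrite /mu /lam lift0.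
  have := ler_normr (- \sum_t (mu t - 1) * Q t) (delta * N).
  move: dev; rewrite ler_norml => /andP[dev _] _; lra.
have [T [sT hT]] := zonal_tensor d sq.
pose u (i : 'I_(size T)) := (tnth (in_tuple T) i).1.
pose v (i : 'I_(size T)) := (tnth (in_tuple T) i).2.
have zE x : zonal q x = \sum_i mpoly_at x (u i) *: v i.
  by rewrite hT (big_tnth _ _ T).
(* The Gram matrix carries a tensor index and a matrix index; its quadratic form at e is the average
   of W^T HH W, nonnegative by [claimB]. *)
pose G (s t : 'I_(size T) * 'I_k) := r * sphere_avg (v s.1 * v t.1 * HH s.2 t.2).
have HHsym a b : HH a b = HH b a.
  by rewrite /HH (hsym a b) eq_sym.
have [||L hL] := @psd_kernel_sum R _ G.
- by move=> s t; rewrite /G HHsym [v s.1 * _]mulrC.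
- move=> e; pose W a := \sum_i e (i, a) *: v i.
  have -> : \sum_s \sum_t e s * e t * G s t =
      r * sphere_avg (\sum_a \sum_b W a * W b * HH a b).
    have pairE (f : 'I_(size T) * 'I_k -> R) : \sum_s f s = \sum_a \sum_i f (i, a).
      by rewrite exchange_big pair_bigA; apply: eq_bigr => -[].
    rewrite sphere_avg_sum mulr_sumr pairE; apply: eq_bigr => a _.
    rewrite sphere_avg_sum mulr_sumr; under eq_bigr do rewrite pairE.
    rewrite exchange_big; apply: eq_bigr => b _.
    rewrite /W sphere_avg_bilinear mulr_sumr; apply: eq_bigr => i _.
    by rewrite mulr_sumr; apply: eq_bigr => j _; rewrite /G mulrCA.
  rewrite mulr_ge0 ?(ltW r0) //; apply: sphere_avg_ge0 => // y yS.
  rewrite mpoly_at_sum; under eq_bigr do rewrite mpoly_at_sum.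
  under eq_bigr do under eq_bigr do rewrite !mpoly_atM.
  exact: claimB.
pose col (z : 'I_(size T) * 'I_k -> R) a := \sum_i z (i, a) *: u i.
(* Each square is the rank one product of a column with its transpose; the column is padded with
   zeros to a square matrix, which uses 0 < k. *)
pose U (z : 'I_(size T) * 'I_k -> R) : 'M[mpoly d R]_k :=
  \matrix_(a, b) if b == Ordinal k0 then col z a else 0.
exists [seq U z | z <- L]; split=> [_ /mapP[z _ ->] a b|x xS].
  rewrite mxE; case: ifP => _; last by rewrite mmeasure0.
  apply: leq_trans (mmeasure_sum _ _ _ _) _; apply/bigmax_leqP => i _.
  by apply: leq_trans (mmeasureZ_le _ _ _) _; apply: sT; exact: mem_tnth.
rewrite big_map; apply/matrixP => a b; rewrite mxE summxE.
transitivity (mpoly_at x (F a b) + delta * (a == b)%:R).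
  rewrite !mxE mpoly_atD; congr (_ + _).
  by case: eqP => _; rewrite ?mulr1n ?mulr0n ?mpoly_atC ?mpoly_at_0 ?mulr1 ?mulr0.
rewrite -claimA // expr2 zonalM zE.
transitivity (\sum_(z <- L) mpoly_at x (col z a) * mpoly_at x (col z b)); last first.
  apply: eq_bigr => z _; rewrite mxE (bigD1 (Ordinal k0)) //= !mxE eqxx big1 ?addr0 //.
  by move=> j /negPf j0; rewrite !mxE j0 mpoly_at_0 mul0r.
transitivity (\sum_i \sum_j mpoly_at x (u i) * mpoly_at x (u j) * G (i, a) (j, b)).
  rewrite sphere_avg_bilinear mulr_sumr; apply: eq_bigr => i _.
  by rewrite mulr_sumr; apply: eq_bigr => j _; rewrite /G mulrCA.
transitivity (\sum_i \sum_j \sum_(z <- L)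
    z (i, a) * mpoly_at x (u i) * (z (j, b) * mpoly_at x (u j))).
  apply: eq_bigr => i _; apply: eq_bigr => j _; rewrite hL mulr_sumr.
  by apply: eq_bigr => z _; ring.
under eq_bigr do rewrite exchange_big.
rewrite exchange_big; apply: eq_bigr => z _.
rewrite /col !mpoly_at_sum mulr_suml; apply: eq_bigr => i _.
by rewrite [RHS]mulr_sumr; apply: eq_bigr => j _; rewrite !mpoly_atZ.
Qed.

End MatrixSosProof.

Theorem theorem6 (R : realType) :
  (forall (n d k l : nat) (F : 'M[mpoly d R]_k),
     (1 <= n)%N -> (2 <= d)%N -> (1 <= k)%N -> (1 <= l)%N ->
     F^T = F ->
     (forall i j, F i j \is @ishomog1 d R (2 * n)%N mdeg) ->
     (forall x, sphere d x ->
        loewner_le 0 (mx_at x F) /\ loewner_le (mx_at x F) 1%:M) ->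
     (rho R n d l < +oo)%E ->
     is_sos l
       (F + (mpolyC d (harmonic_const R n / 2 * fine (rho R n d l)))%:M)) /\
  (forall n : nat, (1 <= n)%N ->
     exists C C' : R, [/\ 0 < C, 0 < C' &
       forall d l : nat, (2 <= d)%N -> (n <= d)%N -> C' * d%:R <= l%:R ->
         (rho R n d l <= (C * (d%:R / l%:R) ^+ 2)%:E)%E]).
Proof.
split=> [n d k l F n1 hd k1 l1 Fs Fh F01 rhooo|n n1].
  exact: sos_of_rho.
have [C [C' [C0 C'0 hC]]] := rho_asymptotics R n.
by exists C, C'; split=> // d l hd _; exact: hC.
Qed.
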